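(* There exists a constant $C\ge 1$ and a universal constant $c>0$ such that the following holds. Let $n\ge 1$ and let $\mu$ be any probability distribution on subsets of $[n]=\{1,\dots,n\}$ with $\mathbb E_{S\sim\mu}|S|^2\ge C$. For distinct $u,v\in[n]$ let $W(u,v)=\Pr_{S\sim\mu}[u,v\in S]$. Then $$\mathsf{cr}(K_n;W) \ge \frac{c}{n}\left(\mathbb E_{S\sim\mu}|S|^2\right)^{5/2},$$ where $K_n$ is the complete graph on $[n]$.
   Context: For a graph $H=(U,F)$ with non-negative edge weights $W:F\to[0,\infty)$, a drawing of $H$ in the plane places the vertices at distinct points and draws each edge as a curve between its endpoints. The crossing weight of a drawing is the total weight of all edge crossings, where each crossing between edges $e,e'$ contributes $W(e)\cdot W(e')$. $\mathsf{cr}(H;W)$ denotes the minimum crossing weight over all drawings of $H$ in the plane. *)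

(* Defs.v *)
From mathcomp Require Import all_boot all_order all_algebra.
From mathcomp Require Import all_classical all_reals all_analysis.
From mathcomp Require Import Rstruct Rstruct_topology.

Set Implicit Arguments.
Unset Strict Implicit.
Unset Printing Implicit Defensive.
Import Order.TTheory GRing.Theory Num.Theory.
Import numFieldNormedType.Exports.
Local Open Scope classical_set_scope.
Local Open Scope ring_scope.

(* Drawings of a graph on vertex set 'I_n (edge relation E, edges {u,v}
   represented by u < v with E u v) in the plane R * R. *)
Section Drawing.
Variable R : realType.
Local Notation point := (R * R)%type.

Definition arc_between (g : R -> point) (p q : point) : Prop :=
  {within [set t : R | 0 <= t <= 1], continuous g} /\
  g 0 = p /\ g 1 = q /\
  (forall s t, 0 <= s <= 1 -> 0 <= t <= 1 -> g s = g t -> s = t).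

Record drawing (n : nat) (E : rel 'I_n) := Drawing {
  dpos : 'I_n -> point;
  dcurve : 'I_n -> 'I_n -> R -> point;
  dpos_inj : injective dpos;
  dcurve_arc : forall u v : 'I_n, (u < v)%N -> E u v ->
     arc_between (dcurve u v) (dpos u) (dpos v);
  dcurve_avoid : forall (u v w : 'I_n) (t : R), (u < v)%N -> E u v -> 0 < t < 1 ->
     dcurve u v t <> dpos w
}.

Definition crossings n E (D : @drawing n E) (u v u' v' : 'I_n) : set point :=
  [set p | exists t t', (0 < t < 1) /\ (0 < t' < 1) /\
      dcurve D u v t = p /\ dcurve D u' v' t' = p].

Definition ncross n E (D : @drawing n E) u v u' v' : \bar R :=
  (\esum_(p in crossings D u v u' v') 1)%E.

Definition is_edge n (E : rel 'I_n) (u v : 'I_n) : bool := (u < v)%N && E u v.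

(* total crossing weight: sum over unordered pairs of distinct edges
   (= half the sum over ordered pairs) of W(e) W(e') * #crossings *)
Definition crossing_weight n E (W : 'I_n -> 'I_n -> R) (D : @drawing n E)
  : \bar R :=
  ((2^-1)%:E *
   \sum_(u < n) \sum_(v < n) \sum_(u' < n) \sum_(v' < n)
     (if is_edge E u v && is_edge E u' v' && ((u, v) != (u', v'))
      then (W u v * W u' v')%:E * ncross D u v u' v'
      else 0))%E.

Definition cr n (E : rel 'I_n) (W : 'I_n -> 'I_n -> R) : \bar R :=
  ereal_inf [set crossing_weight W D | D in [set: @drawing n E]].

End Drawing.

Definition complete_rel (n : nat) : rel 'I_n := fun u v => u != v.

Definition second_moment (R : realType) n (mu : {ffun {set 'I_n} -> R}) : R :=
  \sum_(S : {set 'I_n}) mu S * (#|S| ^ 2)%:R.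

Definition pair_weight (R : realType) n (mu : {ffun {set 'I_n} -> R})
  (u v : 'I_n) : R :=
  \sum_(S : {set 'I_n} | (u \in S) && (v \in S)) mu S.

(* Main.v *)
(* Write P v = Pr[v \in S], so that W(u, v) <= P u, P v, let m = E|S|^2 and
   t = m^(3/2) / (K n).

   A set F of edges on a vertex set A with |F| >= 8|A| contains a K_5 minor, and
   a drawing then has two vertex-disjoint edges of F that meet. Deleting edges
   one by one, F has at least |F| - 8|A| such pairs. This linear bound is
   amplified in two ways. Layer by layer, it bounds the sum of min(w, w') over
   the crossing pairs from below by sum w - 8 sum P for all weights w <= P; this
   is used with w = max(W - t, 0). Averaged over a random subgraph that keeps the
   vertex v with probability min(1, sqrt(P v / t)) and the edge e with
   probability min(1, W e / t), it bounds the sum of the products of these edge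
   probabilities. As sum P <= sqrt m, whichever of the two parts
   max(W - t, 0) and min(W, t) carries half of the total weight gives a crossing
   weight of order t m = m^(5/2) / (K n).

   For the meeting pair in a K_5 minor, replace the arcs by fine polygonal
   approximations in general position and join the branch sets by ten polygonal
   chains. If no two disjoint edges met, neither would two independent chains.
   But the parity of the total number of crossings of independent chains does not
   change when the chains are straightened: a closed polygon is a sum of
   triangles, and a chain crosses a triangle an odd number of times exactly when
   one of its ends is inside; over the three chains independent of a given one,
   each end is counted twice. For five points in general position and straight
   chains this parity is odd. *)

Require Import Defs.
From mathcomp Require Import all_boot all_order all_algebra.
From mathcomp Require Import ring lra zify.
From Stdlib Require Import Btauto.

Set Implicit Arguments.
Unset Strict Implicit.
Unset Printing Implicit Defensive.
Import Order.TTheory GRing.Theory Num.Theory.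

(** * Complete minors in dense graphs *)

Section Minor.
Variable T : finType.
Implicit Types (e : rel T) (A B C : {set T}).

Definition induced e B : rel T := [rel x y | [&& e x y, x \in B & y \in B]].

Definition connected_in e B := {in B &, forall x y, connect (induced e B) x y}.

Definition linked e B C := [exists x in B, exists y in C, e x y].

(* [s] lists the branch sets of a complete minor inside [A]. *)
Definition clique_model e A (s : seq {set T}) :=
  (forall B, B \in s -> [/\ B != set0, B \subset A & connected_in e B]) /\
  pairwise (fun B C => [disjoint B & C] && linked e B C) s.

Definition degree_sum e A := \sum_(x in A) \sum_(y in A) e x y.

Lemma induced_sym e B : symmetric e -> symmetric (induced e B).
Proof. by move=> es x y; rewrite /induced /= es (andbC (y \in B)). Qed.

(** The edge uv is contracted into [u]: the neighbours of [v] are added to those of [u], and [v] is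
    discarded by restricting to [A :\ v]. The test [x != y] removes the loop at [u]. *)
Definition contraction e u v : rel T := fun x y =>
  (x != y) && [|| e x y, (x == u) && e v y | (y == u) && e v x].

Lemma contraction_sym e u v : symmetric e -> symmetric (contraction e u v).
Proof. by move=> es x y; rewrite /contraction eq_sym es (orbC (_ && _)). Qed.

Lemma contraction_irr e u v : irreflexive (contraction e u v).
Proof. by move=> x; rewrite /contraction eqxx. Qed.

(** The contraction loses the edge uv and, for each common neighbour of [u] and [v], one of two
    edges that become parallel. The degree sum counts every edge from both ends, hence the factor
    2. *)
Lemma degree_sum_contraction e A u v : symmetric e -> irreflexive e ->
  u \in A -> v \in A -> e u v ->
  degree_sum e A = degree_sum (contraction e u v) (A :\ v) +
    2 * #|[set w in A | e u w && e v w]|.+1.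
Proof.
move=> es ei uA vA uv.
have vu : u != v by apply/eqP => E; rewrite E ei in uv.
(* [f] marks the neighbours that [u] gains from [v]. *)
pose f y : nat := [&& y != u, e v y & ~~ e u y].
pose S := \sum_(x in A :\ v) \sum_(y in A :\ v) e x y.
pose F := \sum_(y in A :\ v) f y.
have uA' : u \in A :\ v by rewrite !inE vu.
have E1 : degree_sum e A = S + 2 * \sum_(y in A :\ v) e v y.
  rewrite /degree_sum (big_setD1 v vA) //= (big_setD1 v vA) //= ei add0n.
  have -> : \sum_(x in A :\ v) \sum_(y in A) e x y = \sum_(y in A :\ v) e v y + S.
    rewrite -big_split /=; apply: eq_bigr => x _.
    by rewrite (big_setD1 v vA) es.
  by rewrite addnA mul2n addnn addnC.
have E2 : degree_sum (contraction e u v) (A :\ v) = S + 2 * F.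
  rewrite /degree_sum (eq_bigr (fun x => \sum_(y in A :\ v) e x y +
     ((x == u) * F + f x))).
    rewrite big_split /= -/S; congr (_ + _).
    rewrite big_split /= -big_distrl /= (bigD1 u) //= eqxx big1 ?addn0 ?mul1n //.
      by rewrite mul2n addnn.
    by move=> i /andP[_ /negbTE->].
  move=> x xA.
  have -> : f x = \sum_(y in A :\ v) (y == u) * f x.
    rewrite (bigD1 u) //= eqxx big1 ?addn0 ?mul1n //.
    by move=> i /andP[_ /negbTE->].
  rewrite big_distrr /= -!big_split /=; apply: eq_bigr => y yA.
  rewrite /contraction /f.
  have [->|xu] := eqVneq x u; have [->|yu] := eqVneq y u.
  - by rewrite ei.
  - by rewrite /= (es u y); case: (e y u); case: (e v y).
  - by rewrite xu /= (es u x); case: (e x u); case: (e v x).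
  - have [->|xy] := eqVneq x y; first by rewrite ei.
    by rewrite orbF; case: (e x y).
have E3 : \sum_(y in A :\ v) e v y = F + #|[set w in A | e u w && e v w]|.+1.
  have -> : #|[set w in A | e u w && e v w]| = \sum_(y in A :\ v) (e u y && e v y).
    rewrite -sum1_card big_mkcond [RHS]big_mkcond; apply: eq_bigr => y _.
    rewrite !inE; have [->|yv] := eqVneq y v; first by rewrite ei !andbF.
    by case: (y \in A); case: (e u y); case: (e v y).
  rewrite -addn1 addnA /F -big_split /= (bigD1 u) //= [in RHS](bigD1 u) //=.
  rewrite /f eqxx ei /= (es v u) uv addnC addn0 add0n; congr (_ + _).
  by apply: eq_bigr => y /andP[_ yu]; rewrite yu; case: (e u y); case: (e v y).
rewrite E1 E2 E3; lia.
Qed.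

(** The branch set containing [u], if any, absorbs [v]. An edge at [u] that is inherited from [v] is
    then replaced by the original edge at [v], reached from [u] through uv. *)
Lemma clique_model_contraction e A u v s : symmetric e ->
  v \in A -> u \in A -> e u v -> clique_model (contraction e u v) (A :\ v) s ->
  clique_model e A [seq if u \in B then v |: B else B | B <- s].
Proof.
move=> es vA uA uv [sP pw].
set h := fun B : {set T} => if u \in B then v |: B else B.
have subh B : B \subset h B by rewrite /h; case: ifP => // _; apply: subsetUr.
have hv B x : x \in h B -> x \in B \/ u \in B /\ x = v.
  rewrite /h; case: ifP => uB; last by left.
  by rewrite !inE => /orP[/eqP ->|]; [right | left].
have vN B : B \in s -> v \notin B.
  by case/sP => _ /subsetP BA _; apply/negP => /BA; rewrite !inE eqxx.
split.
  move=> _ /mapP[B Bs ->]; have [B0 BA cB] := sP B Bs.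
  split; first by apply: contraNneq B0 => hB; rewrite -subset0 -hB subh.
    apply/subsetP => x /hv[/(subsetP BA)|[_ -> //]].
    by rewrite !inE => /andP[].
  have stp : {in B &, forall x y, connect (induced e (h B)) x y}.
    move=> x y xB yB; have := cB x y xB yB; apply: connect_sub => {x y xB yB} x y.
    case/and3P=> cxy xB yB.
    have xh := subsetP (subh B) x xB; have yh := subsetP (subh B) y yB.
    case/andP: cxy => _ /or3P[exy|/andP[/eqP xu evy]|/andP[/eqP yu evx]].
    - by apply: connect1; rewrite /induced /= exy xh yh.
    - have vh : v \in h B by rewrite /h -xu xB !inE eqxx.
      apply: (@connect_trans _ _ v); apply: connect1; rewrite /induced /= vh.
        by rewrite xu uv -xu xh.
      by rewrite evy yh.
    - have vh : v \in h B by rewrite /h -yu yB !inE eqxx.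
      apply: (@connect_trans _ _ v); apply: connect1; rewrite /induced /= vh.
        by rewrite es evx xh.
      by rewrite yu es uv -yu yh.
  have csym : connect_sym (induced e (h B)) by apply/sym_connect_sym/induced_sym.
  have cv : u \in B -> connect (induced e (h B)) u v.
    move=> uB; apply: connect1; rewrite /induced /= uv (subsetP (subh B)) //=.
    by rewrite /h uB !inE eqxx.
  move=> x y /hv[xB|[uB ->]] /hv[yB|[uB' ->]] //.
  - exact: stp.
  - exact: connect_trans (stp _ _ xB uB') (cv uB').
  - by rewrite csym; apply: connect_trans (stp _ _ yB uB) (cv uB).
rewrite pairwise_map; have al : all (mem s) s by apply/allP.
apply: (sub_in_pairwise _ al pw).
move=> B C Bs Cs /andP[dBC /existsP[x /andP[xB /existsP[y /andP[yC cxy]]]]].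
rewrite /=; apply/andP; split.
  apply/pred0Pn => -[z /andP[/hv zB /hv zC]].
  case: zB => [zB|[uB zv]]; case: zC => [zC|[uC zv']].
  - by move/pred0P: dBC => /(_ z) /=; rewrite zB zC.
  - by have := vN B Bs; rewrite -zv' zB.
  - by have := vN C Cs; rewrite -zv zC.
  - by move/pred0P: dBC => /(_ u) /=; rewrite uB uC.
case/andP: cxy => _ /or3P[exy|/andP[/eqP xu evy]|/andP[/eqP yu evx]].
- apply/existsP; exists x; rewrite (subsetP (subh B)) //=.
  by apply/existsP; exists y; rewrite (subsetP (subh C)) //=.
- have vh : v \in h B by rewrite /h -xu xB !inE eqxx.
  apply/existsP; exists v; rewrite vh /=.
  by apply/existsP; exists y; rewrite (subsetP (subh C)) //=.
- apply/existsP; exists x; rewrite (subsetP (subh B)) //=.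
  have vh : v \in h C by rewrite /h -yu yC !inE eqxx.
  by apply/existsP; exists v; rewrite vh es.
Qed.

(** Mader's argument, with inner induction on [#|A|]. If some edge has fewer than 2^r common
    neighbours, contracting it costs at most 2^(r+1) in the degree sum and one vertex, so the
    density survives. Otherwise the neighbourhood of any vertex with a neighbour has minimum degree
    at least 2^r; it contains r+1 branch sets by induction on [r], and the vertex itself is one
    more. *)
Lemma dense_clique_model r e A : symmetric e -> irreflexive e -> A != set0 ->
  2 ^ r * #|A| <= degree_sum e A ->
  exists2 s, size s = r.+1 & clique_model e A s.
Proof.
elim: r e A => [|r IHr] e A.
  move=> es ei /set0Pn[x xA] _; exists [:: [set x]] => //; split=> // B.
  rewrite inE => /eqP->; rewrite sub1set xA; split=> //.
    by apply/set0Pn; exists x; rewrite inE.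
  by move=> y z; rewrite !inE => /eqP-> /eqP->; apply: connect0.
have [k] := ubnP #|A|; elim: k e A => // k IHk e A leA es ei A0 dA.
have [/existsP[u /existsP[v /and4P[uA vA uv few]]]|many] :=
  boolP [exists u, exists v, [&& u \in A, v \in A, e u v &
     #|[set w in A | e u w && e v w]| < 2 ^ r]].
  have vu : u != v by apply/eqP => E; rewrite E ei in uv.
  have cA : #|A| = #|A :\ v|.+1 by rewrite (cardsD1 v) vA.
  have [|||||s ss sP] := IHk (contraction e u v) (A :\ v).
  - by rewrite -ltnS -cA.
  - exact: contraction_sym.
  - exact: contraction_irr.
  - by apply/set0Pn; exists u; rewrite !inE vu.
  - move: dA; rewrite (degree_sum_contraction es ei uA vA uv) cA expnS; nia.
  exists [seq if u \in B then v |: B else B | B <- s]; first by rewrite size_map.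
  exact: clique_model_contraction.
have [x xA [y yA xy]] : exists2 x, x \in A & exists2 y, y \in A & e x y.
  have [/existsP[x /andP[xA /existsP[y /andP[yA xy]]]]|none] :=
    boolP [exists x in A, [exists y in A, e x y]].
    by exists x => //; exists y.
  move: dA; rewrite leqNgt /degree_sum big1 ?muln_gt0 ?expn_gt0 ?card_gt0 ?A0 //.
  move=> x xA; rewrite big1 // => y yA; case: (boolP (e x y)) => // exy.
  case/negP: none; apply/existsP; exists x; rewrite xA /=.
  by apply/existsP; exists y; rewrite yA.
pose N := [set y in A | e x y].
have [||s ss [sP pw]] := IHr e N es ei.
- by apply/set0Pn; exists y; rewrite inE yA.
- rewrite mulnC -sum_nat_const; apply: leq_sum => u; rewrite inE => /andP[uA xu].
  move: many; rewrite negb_exists => /forallP/(_ x); rewrite negb_exists => /forallP/(_ u).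
  rewrite xA uA xu /= -leqNgt => /leq_trans; apply.
  rewrite -sum1_card big_mkcond [leqRHS]big_mkcond; apply: leq_sum => w _.
  by rewrite !inE; case: (w \in A); case: (e x w); case: (e u w).
have NA : N \subset A by apply/subsetP => z; rewrite inE => /andP[].
have xN : x \notin N by rewrite inE ei andbF.
exists ([set x] :: s); first by rewrite /= ss.
split.
  move=> B; rewrite inE => /orP[/eqP->|Bs]; last first.
    by have [B0 BN cB] := sP B Bs; split=> //; apply: subset_trans NA.
  rewrite sub1set xA; split=> //.
    by apply/set0Pn; exists x; rewrite inE.
  by move=> z w; rewrite !inE => /eqP-> /eqP->; apply: connect0.
rewrite /= pw andbT; apply/allP => B Bs; have [/set0Pn[z zB] BN cB] := sP B Bs.
rewrite disjoints1; apply/andP; split.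
  by apply: contra xN => /(subsetP BN).
apply/existsP; exists x; rewrite inE eqxx /=; apply/existsP; exists z.
by rewrite zB /=; have := subsetP BN z zB; rewrite inE => /andP[].
Qed.

End Minor.

Local Open Scope ring_scope.

(** * Crossing parity of polygonal chains *)

(** Quantification over booleans in computable form, so that a claim about ten signs is settled by
    evaluation. *)
Definition all_bool (P : bool -> bool) := P true && P false.

Lemma all_boolP (P : bool -> bool) : all_bool P -> forall b, P b.
Proof. by case/andP=> ? ? []. Qed.

Section Chirotope.
Variables (L : eqType) (s : L -> L -> L -> bool).

(* The last two axioms are the sign versions of
   [bcd] - [acd] + [abd] - [abc] = 0 and of the Grassmann-Pluecker relation
   [oab][ocd] - [oac][obd] + [oad][obc] = 0 between orientations. *)
Record chirotope : Prop := Chirotope {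
  chi_rot : forall a b c, s b c a = s a b c;
  chi_swap : forall a b c, uniq [:: a; b; c] -> s b a c = ~~ s a b c;
  chi_diag : forall a b, s a a b = false;
  chi_affine : forall a b c d, uniq [:: a; b; c; d] ->
    ~~ [&& s b c d == ~~ s a c d, s b c d == s a b d & s b c d == ~~ s a b c];
  chi_plucker : forall o a b c d, uniq [:: o; a; b; c; d] ->
    ~~ [&& (s o a b (+) s o c d) == ~~ (s o a c (+) s o b d)
         & (s o a b (+) s o c d) == (s o a d (+) s o b c)]
}.

Definition seg_cross a b c d :=
  (s a b c (+) s a b d) && (s c d a (+) s c d b).

(** The point [d] lies on the same side of all three directed sides, whichever way the triangle is
    oriented. *)
Definition in_triangle a b c d := (s a b d == s b c d) && (s b c d == s c a d).

Hypothesis chi : chirotope.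

Lemma seg_crossC a b c d : seg_cross a b c d = seg_cross c d a b.
Proof. by rewrite /seg_cross andbC. Qed.

Lemma chi_perms a b c : uniq [:: a; b; c] ->
  (s b c a = s a b c) * (s c a b = s a b c) *
  (s b a c = ~~ s a b c) * (s a c b = ~~ s a b c) * (s c b a = ~~ s a b c).
Proof.
move=> u; have sw := chi_swap chi u; have rot := chi_rot chi.
have r1 : s c a b = s a b c by rewrite rot.
have r2 : s a c b = s b a c by rewrite rot.
have r3 : s c b a = s b a c by rewrite -(rot b a c) rot.
by rewrite r1 r2 r3 sw rot.
Qed.

Lemma seg_cross_revl a b c d : uniq [:: a; b; c; d] ->
  seg_cross b a c d = seg_cross a b c d.
Proof.
rewrite /= !inE !negb_or => /and4P[/and3P[ab ac ad] /andP[bc bd] cd _].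
have U (x y z : L) : x != y -> x != z -> y != z -> uniq [:: x; y; z].
  by move=> xy xz yz; rewrite /= !inE !negb_or xy xz yz.
rewrite /seg_cross (chi_perms (U _ _ _ ab ac bc)) (chi_perms (U _ _ _ ab ad bd)).
by move: (s a b c) (s a b d) (s c d a) (s c d b) => [] [] [] [].
Qed.

Lemma seg_cross_diag a c d : seg_cross a a c d = false.
Proof. by rewrite /seg_cross !(chi_diag chi). Qed.

Lemma in_triangle_diag a b d : uniq [:: a; b; d] -> in_triangle a a b d = false.
Proof.
move=> u; rewrite /in_triangle (chi_diag chi) (chi_swap chi u).
by case: (s a b d).
Qed.

Lemma in_triangle_rot a b c d : in_triangle b c a d = in_triangle a b c d.
Proof. by rewrite /in_triangle; do 3!case: (s _ _ d). Qed.

(** Every term depends only on the ten orientations of the five points. The Grassmann-Pluecker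
    relations based at [d] and at [e] exclude all sign patterns that violate the identity, as
    evaluation of the 2^10 cases shows. *)
Lemma triangle_parity_uniq a b c d e : uniq [:: a; b; c; d; e] ->
  seg_cross a b d e (+) seg_cross b c d e (+) seg_cross c a d e =
  in_triangle a b c d (+) in_triangle a b c e.
Proof.
move=> u.
have := u; rewrite /= !inE !negb_or !andbT.
move=> /and4P[/and4P[ab ac ad ae] /and3P[bc bd be] /andP[cd ce] de].
have U (x y z : L) : x != y -> x != z -> y != z -> uniq [:: x; y; z].
  by move=> xy xz yz; rewrite /= !inE !negb_or xy xz yz.
have P1 : uniq [:: d; a; b; c; e].
  by rewrite /= !inE !negb_or ab ac bc de ae be ce !(eq_sym d) ad bd cd.
have P2 : uniq [:: e; a; b; c; d].
  by rewrite /= !inE !negb_or ab ac bc !(eq_sym e) de ae be ce ad bd cd.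
move: (chi_plucker chi P1) (chi_plucker chi P2).
rewrite /seg_cross /in_triangle.
rewrite ?(chi_perms (U _ _ _ ab ac bc)) ?(chi_perms (U _ _ _ ab ad bd)) ?(chi_perms (U _ _ _ ab ae be))
  ?(chi_perms (U _ _ _ ac ad cd)) ?(chi_perms (U _ _ _ ac ae ce)) ?(chi_perms (U _ _ _ ad ae de))
  ?(chi_perms (U _ _ _ bc bd cd)) ?(chi_perms (U _ _ _ bc be ce)) ?(chi_perms (U _ _ _ bd be de))
  ?(chi_perms (U _ _ _ cd ce de)).
move: (s a b c) (s a b d) (s a b e) (s a c d) (s a c e) (s a d e) (s b c d) (s b c e) (s b d e) (s c d e).
move=> x1 x2 x3 x4 x5 x6 x7 x8 x9 x10.
move=> H1 H2; apply/eqP; move: H2; apply/implyP; move: H1; apply/implyP.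
move: x10; apply: all_boolP; move: x9; apply: all_boolP; move: x8; apply: all_boolP;
move: x7; apply: all_boolP; move: x6; apply: all_boolP; move: x5; apply: all_boolP;
move: x4; apply: all_boolP; move: x3; apply: all_boolP; move: x2; apply: all_boolP;
move: x1; apply: all_boolP.
by vm_compute.
Qed.

(** Chains are walks that may repeat labels, so degenerate triangles have to be covered. When two
    corners coincide, the other two sides are one segment in both directions and cancel. *)
Lemma triangle_parity a b c d e : d \notin [:: a; b; c] -> e \notin [:: a; b; c] ->
  seg_cross a b d e (+) seg_cross b c d e (+) seg_cross c a d e =
  in_triangle a b c d (+) in_triangle a b c e.
Proof.
move=> dN eN.
have [<-|de] := eqVneq d e.
  by rewrite !(seg_crossC _ _ d d) !seg_cross_diag !addbb.
have N3 (x y : L) : x != y -> d != x -> d != y -> e != x -> e != y -> uniq [:: x; y; d; e].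
  by move=> xy dx dy ex ey; rewrite /= !inE !negb_or xy de !(eq_sym _ d) !(eq_sym _ e) dx dy ex ey.
have T3 (x y z : L) : x != y -> z != x -> z != y -> uniq [:: x; y; z].
  by move=> xy zx zy; rewrite /= !inE !negb_or xy !(eq_sym _ z) zx zy.
move: (dN) (eN); rewrite !inE !negb_or => /and3P[da db dc] /and3P[ea eb ec].
have deg x y : d != x -> d != y -> e != x -> e != y ->
  seg_cross x x d e (+) seg_cross x y d e (+) seg_cross y x d e =
  in_triangle x x y d (+) in_triangle x x y e.
  move=> dx dy ex ey; have [<-|xy] := eqVneq x y.
    by rewrite /in_triangle !seg_cross_diag !(chi_diag chi).
  by rewrite !in_triangle_diag ?T3 // seg_cross_diag (seg_cross_revl (N3 x y xy dx dy ex ey)) /= ?addbb.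
have [ab|ab] := eqVneq a b; first by subst b; exact: deg.
have [bc|bc] := eqVneq b c.
  subst c; rewrite -(in_triangle_rot a) -(in_triangle_rot a b b e) -deg //.
  by rewrite [RHS]addbC addbA.
have [ca|ca] := eqVneq c a.
  subst c; rewrite (in_triangle_rot a a b) (in_triangle_rot a a b) -deg //.
  by rewrite addbC addbA.
apply: triangle_parity_uniq.
by rewrite /= !inE !negb_or ab bc de (eq_sym a c) ca !(eq_sym _ d) da db dc !(eq_sym _ e) ea eb ec.
Qed.

Lemma seg_cross_rev a b c d : c \notin [:: a; b] -> d \notin [:: a; b] ->
  seg_cross b a c d = seg_cross a b c d.
Proof.
rewrite !inE !negb_or => /andP[ca cb] /andP[da db].
have [<-|ab] := eqVneq a b; first by [].
have [<-|cd] := eqVneq c d; first by rewrite !(seg_crossC _ _ c) !seg_cross_diag.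
by apply: seg_cross_revl; rewrite /= !inE !negb_or ab cd !(eq_sym _ c) !(eq_sym _ d) ca cb da db.
Qed.

(** The fifteen terms are the pairs of independent edges of the straight-line K_5. The affine
    relations of the five quadruples already exclude every sign pattern of even parity. *)
Lemma straight_K5_parity a b c d e : uniq [:: a; b; c; d; e] ->
  seg_cross a b c d (+)
  seg_cross a b c e (+)
  seg_cross a b d e (+)
  seg_cross a c b d (+)
  seg_cross a c b e (+)
  seg_cross a c d e (+)
  seg_cross a d b c (+)
  seg_cross a d b e (+)
  seg_cross a d c e (+)
  seg_cross a e b c (+)
  seg_cross a e b d (+)
  seg_cross a e c d (+)
  seg_cross b c d e (+)
  seg_cross b d c e (+)
  seg_cross b e c d.
Proof.
move=> u.
have := u; rewrite /= !inE !negb_or !andbT.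
move=> /and4P[/and4P[ab ac ad ae] /and3P[bc bd be] /andP[cd ce] de].
have U (x y z : L) : x != y -> x != z -> y != z -> uniq [:: x; y; z].
  by move=> xy xz yz; rewrite /= !inE !negb_or xy xz yz.
have V (x y z t : L) : x != y -> x != z -> x != t -> y != z -> y != t -> z != t ->
    uniq [:: x; y; z; t].
  by move=> xy xz xt yz yt zt; rewrite /= !inE !negb_or xy xz xt yz yt zt.
move: (chi_affine chi (V _ _ _ _ ab ac ad bc bd cd))
  (chi_affine chi (V _ _ _ _ ab ac ae bc be ce))
  (chi_affine chi (V _ _ _ _ ab ad ae bd be de))
  (chi_affine chi (V _ _ _ _ ac ad ae cd ce de))
  (chi_affine chi (V _ _ _ _ bc bd be cd ce de)).
rewrite /seg_cross.
rewrite ?(chi_perms (U _ _ _ ab ac bc))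
  ?(chi_perms (U _ _ _ ab ad bd))
  ?(chi_perms (U _ _ _ ab ae be))
  ?(chi_perms (U _ _ _ ac ad cd))
  ?(chi_perms (U _ _ _ ac ae ce))
  ?(chi_perms (U _ _ _ ad ae de))
  ?(chi_perms (U _ _ _ bc bd cd))
  ?(chi_perms (U _ _ _ bc be ce))
  ?(chi_perms (U _ _ _ bd be de))
  ?(chi_perms (U _ _ _ cd ce de)).
move: (s a b c) (s a b d) (s a b e) (s a c d) (s a c e) (s a d e) (s b c d) (s b c e) (s b d e) (s c d e).
move=> x1 x2 x3 x4 x5 x6 x7 x8 x9 x10.
move=> H1 H2 H3 H4 H5; move: H5; apply/implyP; move: H4; apply/implyP; move: H3; apply/implyP.
move: H2; apply/implyP; move: H1; apply/implyP.
move: x10; apply: all_boolP; move: x9; apply: all_boolP; move: x8; apply: all_boolP;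
move: x7; apply: all_boolP; move: x6; apply: all_boolP; move: x5; apply: all_boolP;
move: x4; apply: all_boolP; move: x3; apply: all_boolP; move: x2; apply: all_boolP;
move: x1; apply: all_boolP.
by vm_compute.
Qed.

Lemma addb_false (p q : bool) : p (+) q = false -> p = q.
Proof. by case: p q => [] []. Qed.

Fixpoint chain_seg_cross x t d e : bool :=
  if t is y :: t' then seg_cross x y d e (+) chain_seg_cross y t' d e else false.

Fixpoint chain_cross x t d u : bool :=
  if u is e :: u' then chain_seg_cross x t d e (+) chain_cross x t e u' else false.

(** The winding number modulo 2, around [p], of the closed polygon from [o] along [x :: t] and back,
    computed from the triangles with apex [o]. *)
Fixpoint fan_parity o x t p : bool :=
  if t is y :: t' then in_triangle o x y p (+) fan_parity o y t' p else false.

(** Add [triangle_parity] over the fan: each inner spoke from [o] belongs to two triangles and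
    cancels, which leaves the chain and the two outer spokes. *)
Lemma fan_cross_parity o x t d e : d \notin o :: x :: t -> e \notin o :: x :: t ->
  chain_seg_cross x t d e (+) (seg_cross o x d e (+) seg_cross o (last x t) d e) =
  fan_parity o x t d (+) fan_parity o x t e.
Proof.
elim: t x => [|y t IH] x; first by rewrite /= addbb.
rewrite !(inE, negb_or) => /and4P[d_o dx dy dt] /and4P[e_o ex ey et] /=.
have := IH y; rewrite !inE !negb_or d_o dy dt e_o ey et => /(_ isT isT) E.
rewrite [RHS]addbACA -E -triangle_parity; last 2 first.
- by rewrite !inE !negb_or d_o dx dy.
- by rewrite !inE !negb_or e_o ex ey.
rewrite (@seg_cross_rev o y) ?inE ?negb_or ?d_o ?e_o //.
move: (seg_cross x y d e) (chain_seg_cross _ _ _ _) (seg_cross o x d e)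
  (seg_cross o y d e) (seg_cross o (last y t) d e).
by do 5!case.
Qed.

Definition chain_parity x t p := fan_parity x x t p.

(* Closing a chain by the segment joining its ends gives a sum of triangles of
   the fan based at its first point, hence the winding corrections. *)
Lemma chain_crossE x t d u : {in x :: t, forall a, a \notin d :: u} ->
  chain_cross x t d u = seg_cross x (last x t) d (last d u)
    (+) ((chain_parity x t d (+) chain_parity x t (last d u))
    (+) (chain_parity d u x (+) chain_parity d u (last x t))).
Proof.
move=> dis.
have in_cons2 (p q : L) w : p \notin q :: w -> p \notin q :: q :: w.
  by rewrite !inE orbA orbb.
have dis' p : p \in d :: u -> p \notin x :: t.
  by move=> pu; apply/negP => /dis; rewrite pu.
(* The first chain is straightened against each edge of the second; the winding parities telescope
   to those at the two ends of the second chain. *)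
have step v y : {subset y :: v <= d :: u} -> chain_cross x t y v =
    chain_seg_cross y v x (last x t) (+)
      (chain_parity x t y (+) chain_parity x t (last y v)).
  elim: v y => [|z v IH] y sub /=; first by rewrite addbb.
  rewrite IH; last by move=> p pv; apply: sub; rewrite inE pv orbT.
  have yN := dis' y (sub y (mem_head _ _)).
  have zN : z \notin x :: t by apply/dis'/sub; rewrite !inE eqxx orbT.
  have := fan_cross_parity (in_cons2 _ _ _ yN) (in_cons2 _ _ _ zN).
  rewrite seg_cross_diag addFb (seg_crossC x) => E.
  rewrite -/(chain_parity x t y) -/(chain_parity x t z) in E.
  move: E; move: (chain_parity x t y) (chain_parity x t z) (chain_parity x t (last z v)).
  move: (chain_seg_cross x t y z) (chain_seg_cross z v _ _) (seg_cross y z _ _).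
  by do 6!case.
rewrite step //.
(* It remains to straighten the second chain against the single segment joining the ends of the
   first, with the fan of the second chain. *)
have xN : x \notin d :: u := dis _ (mem_head _ _).
have lN : last x t \notin d :: u := dis _ (mem_last _ _).
have := fan_cross_parity (in_cons2 _ _ _ xN) (in_cons2 _ _ _ lN).
rewrite seg_cross_diag addFb (seg_crossC d).
rewrite -/(chain_parity d u x) -/(chain_parity d u (last x t)).
move: (chain_parity d u x) (chain_parity d u (last x t)) (chain_parity x t d (+) _).
move: (chain_seg_cross _ _ _ _) (seg_cross _ _ _ _).
by do 5!case.
Qed.

(** If all independent chains crossed evenly, each straight crossing would equal its four winding
    corrections. These cancel in the total, contrary to [straight_K5_parity]. *)
Lemma K5_chains_cross (c : nat -> L) (ch : nat -> nat -> seq L) :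
  uniq [:: c 0%N; c 1%N; c 2%N; c 3%N; c 4%N] ->
  (forall i j, (i < j < 5)%N -> last (c i) (ch i j) = c j) ->
  (forall i j k l, (i < j < 5)%N -> (k < l < 5)%N -> uniq [:: i; j; k; l] ->
     {in c i :: ch i j, forall a, a \notin c k :: ch k l} /\
     chain_cross (c i) (ch i j) (c k) (ch k l) = false) -> False.
Proof.
move=> uc lastP H.
have E i j k l : (i < j < 5)%N -> (k < l < 5)%N -> uniq [:: i; j; k; l] ->
    seg_cross (c i) (c j) (c k) (c l) =
    ((chain_parity (c i) (ch i j) (c k) (+) chain_parity (c i) (ch i j) (c l))
    (+) (chain_parity (c k) (ch k l) (c i) (+) chain_parity (c k) (ch k l) (c j))).
  move=> ij kl u; have [dis] := H i j k l ij kl u.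
  by rewrite (chain_crossE dis) !lastP // => /addb_false.
have := straight_K5_parity uc.
rewrite !E //.
(* Ten chains, each with the three points that are not its ends, give thirty parities; each occurs
   twice among the sixty corrections. *)
do 30![move: (chain_parity _ _ _) => ?].
have addbE (a b : bool) : a (+) b = xorb a b by case: a; case: b.
rewrite !addbE => h.
suff: false = true by [].
rewrite -[RHS]h; btauto.
Qed.
End Chirotope.

(** * Orientations, crossing segments and general position in the plane *)

Section Orientation.
Variable R : realFieldType.
Local Notation point := (R * R)%type.
Implicit Types p q r : point.

Definition orientation p q r : R :=
  (q.1 - p.1) * (r.2 - p.2) - (q.2 - p.2) * (r.1 - p.1).

Section Labelled.
Variables (L : eqType) (f : L -> point).

Definition general_position :=
  forall i j k, uniq [:: i; j; k] -> orientation (f i) (f j) (f k) != 0.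

Definition counterclockwise i j k := 0 < orientation (f i) (f j) (f k).

Lemma sign_mul (x y : R) : x != 0 -> y != 0 -> (0 < x) (+) (0 < y) = (x * y < 0).
Proof.
move=> x0 y0; case: (ltrgt0P x) x0 => // hx _; case: (ltrgt0P y) y0 => // hy _ /=; apply/esym.
- by apply/negbTE; rewrite -leNgt mulr_ge0 ?ltW.
- by rewrite pmulr_rlt0.
- by rewrite nmulr_rlt0.
- by apply/negbTE; rewrite -leNgt mulr_le0 ?ltW.
Qed.

(** In a forbidden sign pattern the signed terms of the corresponding identity would all point the
    same way, with the first one nonzero, so they could not sum to 0. *)
Lemma chirotope_counterclockwise : general_position -> chirotope counterclockwise.
Proof.
move=> gen; split; rewrite /counterclockwise.
- by move=> a b c; congr (0 < _); rewrite /orientation; ring.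
- move=> a b c u.
  have -> : orientation (f b) (f a) (f c) = - orientation (f a) (f b) (f c).
    by rewrite /orientation; ring.
  by rewrite oppr_gt0 -leNgt le_eqVlt (negbTE (gen _ _ _ u)).
- by move=> a b; rewrite /orientation; apply/negbTE; rewrite -leNgt; lra.
- move=> a b c d u.
  have u' : uniq [:: b; c; d] by move: u; rewrite (cons_uniq a) => /andP[].
  have := gen _ _ _ u'.
  have : orientation (f b) (f c) (f d) - orientation (f a) (f c) (f d) +
    orientation (f a) (f b) (f d) - orientation (f a) (f b) (f c) = 0.
    by rewrite /orientation; ring.
  move: (orientation (f b) (f c) (f d)) (orientation (f a) (f c) (f d))
    (orientation (f a) (f b) (f d)) (orientation (f a) (f b) (f c)).
  move=> x y z t E x0; apply/negP.
  case: (ltrgt0P x) x0 => // hx _; case: (lerP y 0) => hy; case: (lerP z 0) => hz;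
    case: (lerP t 0) => ht //= _; lra.
- move=> o a b c d u.
  have := u; rewrite /= !inE !negb_or !andbT.
  move=> /and4P[/and4P[oa ob oc od] /and3P[ab ac ad] /andP[bc bd] cd].
  have U (x y z : L) : x != y -> x != z -> y != z -> orientation (f x) (f y) (f z) != 0.
    by move=> xy xz yz; apply: gen; rewrite /= !inE !negb_or xy xz yz.
  rewrite !sign_mul ?U //.
  have : orientation (f o) (f a) (f b) * orientation (f o) (f c) (f d) -
    orientation (f o) (f a) (f c) * orientation (f o) (f b) (f d) +
    orientation (f o) (f a) (f d) * orientation (f o) (f b) (f c) = 0.
    by rewrite /orientation; ring.
  have := mulf_neq0 (U _ _ _ oa ob ab) (U _ _ _ oc od cd).
  move: (_ * orientation (f o) (f c) (f d)) (_ * orientation (f o) (f b) (f d))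
    (_ * orientation (f o) (f b) (f c)) => x y z x0 E; apply/negP.
  case: (ltrgt0P x) x0 => // hx _; case: (ltrP y 0) => hy; case: (ltrP z 0) => hz //= _; lra.
Qed.

End Labelled.

(** Two equal weighted averages, one bounded below by [l] and one above by [h]. The weights have a
    common positive total instead of 1, which avoids divisions. *)
Lemma convex_combination_le (a b c d l h x y z t : R) : 0 <= x -> 0 <= y -> 0 <= z -> 0 <= t ->
  0 < x + y -> x + y = z + t -> x * a + y * b = z * c + t * d ->
  l <= a -> l <= b -> c <= h -> d <= h -> l <= h.
Proof.
move=> x0 y0 z0 t0 xy E1 E2 la lb ch dh.
have H1 := ler_wpM2l x0 la; have H2 := ler_wpM2l y0 lb.
have H3 := ler_wpM2l z0 ch; have H4 := ler_wpM2l t0 dh.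
rewrite -(ler_pM2l xy); apply: (@le_trans _ _ (x * a + y * b)); first by lra.
by rewrite E1 E2; lra.
Qed.

(* The coefficients come from [bcd] a - [acd] b + [abd] c - [abc] d = 0. *)
Lemma seg_cross_coords (L : eqType) (f : L -> point) a b c d :
  seg_cross (counterclockwise f) a b c d ->
  exists x y z t : R, [/\ [/\ 0 <= x, 0 <= y, 0 <= z & 0 <= t], 0 < x + y, x + y = z + t,
    x * (f a).1 + y * (f b).1 = z * (f c).1 + t * (f d).1 &
    x * (f a).2 + y * (f b).2 = z * (f c).2 + t * (f d).2].
Proof.
rewrite /seg_cross /counterclockwise.
pose x := orientation (f c) (f d) (f b); pose y := orientation (f c) (f d) (f a).
pose z := orientation (f a) (f b) (f d); pose t := orientation (f a) (f b) (f c).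
have E : x - y = t - z by rewrite /x /y /z /t /orientation; ring.
have E1 : x * (f a).1 - y * (f b).1 = t * (f d).1 - z * (f c).1.
  by rewrite /x /y /z /t /orientation; ring.
have E2 : x * (f a).2 - y * (f b).2 = t * (f d).2 - z * (f c).2.
  by rewrite /x /y /z /t /orientation; ring.
rewrite -/x -/y -/z -/t; move: E E1 E2; move: x y z t => x y z t E E1 E2.
case: (lerP x 0) => hx; case: (lerP y 0) => hy; case: (lerP z 0) => hz;
  case: (lerP t 0) => ht //= _; try (exfalso; lra).
(* Only two sign patterns are consistent with [E]; in each, two of the coefficients are negated to
   make all four nonnegative. *)
- exists (- x), y, z, (- t); split; [split | | | | ]; lra.
- exists x, (- y), (- z), t; split; [split | | | | ]; lra.
Qed.

(** The common point of the segments is an average of the ends of either one, hence within [e] of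
    both [p] and [q] in each coordinate. *)
Lemma seg_cross_near (L : eqType) (f : L -> point) a b c d p q (e : R) :
  seg_cross (counterclockwise f) a b c d ->
  {in [:: a; b], forall i, `|(f i).1 - p.1| <= e /\ `|(f i).2 - p.2| <= e} ->
  {in [:: c; d], forall i, `|(f i).1 - q.1| <= e /\ `|(f i).2 - q.2| <= e} ->
  `|p.1 - q.1| <= 2 * e /\ `|p.2 - q.2| <= 2 * e.
Proof.
case/seg_cross_coords=> x [y [z [t [[x0 y0 z0 t0] xy E E1 E2]]]] Hp Hq.
have [] := Hp a (mem_head _ _); have [|] := Hp b; first by rewrite !inE eqxx orbT.
have [] := Hq c (mem_head _ _); have [|] := Hq d; first by rewrite !inE eqxx orbT.
rewrite !ler_norml => /andP[? ?] /andP[? ?] /andP[? ?] /andP[? ?].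
move=> /andP[? ?] /andP[? ?] /andP[? ?] /andP[? ?].
have zt : 0 < z + t by rewrite -E.
split; apply/andP; split.
- suff : q.1 - e <= p.1 + e by lra.
  by apply: (convex_combination_le z0 t0 x0 y0 zt (esym E) (esym E1)); clear E E1 E2 x0 y0 z0 t0 xy zt; lra.
- suff : p.1 - e <= q.1 + e by lra.
  by apply: (convex_combination_le x0 y0 z0 t0 xy E E1); clear E E1 E2 x0 y0 z0 t0 xy zt; lra.
- suff : q.2 - e <= p.2 + e by lra.
  by apply: (convex_combination_le z0 t0 x0 y0 zt (esym E) (esym E2)); clear E E1 E2 x0 y0 z0 t0 xy zt; lra.
- suff : p.2 - e <= q.2 + e by lra.
  by apply: (convex_combination_le x0 y0 z0 t0 xy E E2); clear E E1 E2 x0 y0 z0 t0 xy zt; lra.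
Qed.

(** The [size p] distinct candidates d / (j + 1) are too many to be all roots of [p]. *)
Lemma small_nonroot (p : {poly R}) (d : R) : p != 0 -> 0 < d ->
  exists2 e, 0 < e <= d & ~~ root p e.
Proof.
move=> p0 d0; pose s := [seq d / j.+1%:R | j <- iota 0 (size p)].
have [|] := boolP (all (root p) s).
  move=> /(max_poly_roots p0); rewrite size_map size_iota ltnn => H.
  suff /H : uniq s by [].
  rewrite map_inj_in_uniq ?iota_uniq // => i j _ _ /(mulfI (lt0r_neq0 d0)) /invr_inj /eqP.
  by rewrite eqr_nat => /eqP[].
move=> /allPn[e /mapP[j _ ->] nr]; exists (d / j.+1%:R) => //.
by rewrite divr_gt0 //= ler_pdivrMr // ler_peMr ?ler1n // ltW.
Qed.

(** Shift the point of rank r by e (r, r^2), along the moment curve. The orientation of a triple is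
    a polynomial in e whose e^2 coefficient is a Vandermonde product of distinct ranks, hence
    nonzero; a small e avoids the roots of all these polynomials at once. *)
Lemma perturb_general_position (L : finType) (f : L -> point) (d : R) : 0 < d ->
  exists2 g : L -> point, general_position g &
    forall i, `|(g i).1 - (f i).1| <= d /\ `|(g i).2 - (f i).2| <= d.
Proof.
move=> d0.
pose r (i : L) : R := (enum_rank i)%:R.
pose g e i : point := ((f i).1 + e * r i, (f i).2 + e * r i ^+ 2).
pose vdm i j k := (r j - r i) * (r k - r i) * (r k - r j).
pose lin i j k := (r j - r i) * ((f k).2 - (f i).2) + ((f j).1 - (f i).1) * (r k ^+ 2 - r i ^+ 2)
  - (r j ^+ 2 - r i ^+ 2) * ((f k).1 - (f i).1) - ((f j).2 - (f i).2) * (r k - r i).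
pose Q i j k : {poly R} := (orientation (f i) (f j) (f k))%:P + lin i j k *: 'X + vdm i j k *: 'X^2.
have QE e i j k : (Q i j k).[e] = orientation (g e i) (g e j) (g e k).
  by rewrite /Q !hornerE /orientation /lin /vdm /=; ring.
have Q0 i j k : uniq [:: i; j; k] -> Q i j k != 0.
  rewrite /= !inE negb_or andbT => /andP[/andP[ij ik] jk].
  apply: contraTneq isT => /(congr1 (fun p : {poly R} => p`_2)).
  rewrite /Q !coefD coefC !coefZ coefX coefXn coef0 /= mulr0 mulr1 !add0r /vdm => /eqP.
  have rI x y : x != y -> r x - r y != 0.
    by move=> xy; rewrite subr_eq0 eqr_nat; apply: contra xy => /eqP /ord_inj /enum_rank_inj ->.
  by rewrite !mulf_eq0 !(negbTE (rI _ _ _)) // eq_sym.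
pose P := \prod_(t : L * L * L | uniq [:: t.1.1; t.1.2; t.2]) Q t.1.1 t.1.2 t.2.
have P0 : P != 0 by rewrite /P prodf_seq_neq0; apply/allP => t _; apply/implyP; apply: Q0.
(* [M] bounds both r and r^2, so both coordinates move by at most [e * M]. *)
pose M : R := #|L|%:R ^+ 2 + 1.
have M0 : 0 < M by rewrite ltr_wpDl // sqr_ge0.
have [|e /andP[e0 eM] nr] := small_nonroot P0 (d := d / M); first exact: divr_gt0.
exists (g e).
  move=> i j k u; rewrite -QE; apply: contra nr => /eqP Qe.
  by rewrite /root /P (bigD1 (i, j, k)) //= hornerM Qe mul0r.
have eMd : e * M <= d by rewrite -ler_pdivlMr.
move=> i; have ri : 0 <= r i by rewrite ler0n.
have rM : r i <= #|L|%:R by rewrite ler_nat ltnW // ltn_ord.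
rewrite /g /= !(addrC (_ + _) (- _)) !addKr !ger0_norm ?mulr_ge0 ?exprn_ge0 ?(ltW e0) //.
have m0 : 0 <= #|L|%:R :> R by [].
split; apply: le_trans eMd; rewrite ler_pM2l // /M; first by nra.
by nra.
Qed.

End Orientation.

(** * Amplifying the linear bound *)

(** For probabilities [p] this computes Pr[D is contained in S], where S contains each i
    independently with probability [p i]. The event is imposed by replacing the factor [1 - p i] by
    0 on [D]; then the product is expanded. *)
Lemma sum_bernoulli (R : comNzRingType) (I : finType) (p : I -> R) (D : {set I}) :
  \sum_(S : {set I}) (\prod_i if i \in S then p i else 1 - p i) * (D \subset S)%:R
  = \prod_(i in D) p i.
Proof.
transitivity (\sum_(S : {set I}) \prod_i (if i \in S then p i else if i \in D then 0 else 1 - p i)).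
  apply: eq_bigr => S _; have [DS|/subsetPn[i iD iS]] := boolP (D \subset S).
    rewrite mulr1; apply: eq_bigr => i _; case: ifP => // /negbT iS.
    by rewrite (negbTE (contra (subsetP DS i) iS)).
  by rewrite mulr0 (bigD1 i) //= (negbTE iS) iD mul0r.
rewrite -bigA_distr [RHS]big_mkcond; apply: eq_bigr => i _.
by case: ifP => _ /=; [rewrite addr0 | rewrite addrC subrK].
Qed.

Lemma sum_bernoulli_seq (R : comNzRingType) (I : finType) (p : I -> R) (s : seq I) : uniq s ->
  \sum_(S : {set I}) (\prod_i if i \in S then p i else 1 - p i) * (all (mem S) s)%:R
  = \prod_(i <- s) p i.
Proof.
move=> us; have -> : \prod_(i <- s) p i = \prod_(i in [set i in s]) p i.
  by rewrite big_uniq //; apply: eq_bigl => i; rewrite inE.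
rewrite -sum_bernoulli.
apply: eq_bigr => S _; congr (_ * (nat_of_bool _)%:R).
apply/allP/subsetP => H i; first by rewrite inE => /H.
by move=> si; apply: H; rewrite inE.
Qed.

(** Serves to bound an edge probability by the product of its two vertex probabilities: [z] is at
    most the smaller of the two squares, hence at most [y1 * y2]. *)
Lemma min_le_mul_min (R : realDomainType) (y1 y2 z : R) : 0 <= z -> 0 <= y1 -> 0 <= y2 ->
  z <= y1 ^+ 2 -> z <= y2 ^+ 2 -> Num.min z 1 <= Num.min 1 y1 * Num.min 1 y2.
Proof.
move=> z0 h1 h2 z1 z2; rewrite ge_min.
case: (lerP 1 y1) => y11; case: (lerP 1 y2) => y21; rewrite ?mul1r ?mulr1.
- by rewrite lexx orbT.
- by apply/orP; left; nra.
- by apply/orP; left; nra.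
- by apply/orP; left; case: (lerP y1 y2) => y12; nra.
Qed.

Section Crossings.
Variable n : nat.
Local Notation edge := ('I_n * 'I_n)%type.
Implicit Types (F : {set edge}) (A : {set 'I_n}) (a b : edge) (X : rel edge).

Definition edge_rel F : rel 'I_n := fun u v => ((u, v) \in F) || ((v, u) \in F).

Definition oriented a := (a.1 < a.2)%N.

(* [X] marks pairs of vertex-disjoint edges meeting in a drawing. *)
Definition forces_crossing X := forall F A s, {in F, forall a, oriented a} ->
  clique_model (edge_rel F) A s -> size s = 5 ->
  exists a b, [/\ a \in F, b \in F & X a b].

Definition vertex_disjoint a b := uniq [:: a.1; a.2; b.1; b.2].

(** Ordered pairs are counted, so a symmetric [X] contributes each crossing pair twice; this is why
    the linear bounds below are stated in doubled form. *)
Definition crossing_count X F : nat := \sum_(a in F) \sum_(b in F) X a b.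

Lemma degree_sum_edge_rel F A : {in F, forall a, [/\ oriented a, a.1 \in A & a.2 \in A]} ->
  degree_sum (edge_rel F) A = (2 * #|F|)%N.
Proof.
move=> FA; rewrite /degree_sum pair_big /=.
have -> : (2 * #|F| = \sum_(p : edge | (p.1 \in A) && (p.2 \in A)) ((p \in F) + ((p.2, p.1) \in F)))%N.
  rewrite big_split /= mul2n -addnn -sum1_card; congr (_ + _)%N.
    rewrite big_mkcond [RHS]big_mkcond; apply: eq_bigr => p _.
    by case: ifP => [/FA[_ -> ->] |_] //; case: (_ && _).
  have swK : involutive (fun p : edge => (p.2, p.1)) by case.
  rewrite (reindex_inj (inv_inj swK)) /= big_mkcond [RHS]big_mkcond.
  apply: eq_bigr => -[u v] _ /=.
  by case: ifP => [/FA[_ /= -> ->] |_] //; case: (_ && _).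
apply: eq_bigr => -[u v] _ /=; rewrite /edge_rel.
case: (boolP ((u, v) \in F)) => // /FA[uv _ _].
case: (boolP ((v, u) \in F)) => // /FA[vu _ _].
by rewrite /oriented /= in uv vu; lia.
Qed.

Lemma edge_rel_sym F : symmetric (edge_rel F).
Proof. by move=> u v; rewrite /edge_rel orbC. Qed.

Lemma edge_rel_irr F : {in F, forall a, oriented a} -> irreflexive (edge_rel F).
Proof.
move=> oF u; rewrite /edge_rel orbb; apply/negP => /oF.
by rewrite /oriented ltnn.
Qed.

Section Linear.
Variable X : rel edge.
Hypotheses (Xsym : symmetric X) (Xforced : forces_crossing X).
Hypothesis Xdisj : forall a b, X a b -> vertex_disjoint a b.

(** While the degree sum 2|F| is at least 2^4 |A|, there is a K_5 model and thus a crossing pair;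
    remove one of its edges and induct. *)
Lemma crossing_count_linear F A :
  {in F, forall a, [/\ oriented a, a.1 \in A & a.2 \in A]} ->
  (2 * #|F| <= 16 * #|A| + crossing_count X F)%N.
Proof.
have [k] := ubnP #|F|; elim: k F => // k IHk F leF FA.
have [small|large] := ltnP (2 * #|F|) (16 * #|A|).
  by rewrite ltnW // ltn_addr.
have oF : {in F, forall a, oriented a} by move=> a /FA[].
(* [dense_clique_model] needs a vertex; without one there is no edge either. *)
have [A0|A0] := eqVneq A set0.
  suff -> : F = set0 by rewrite cards0.
  by apply/setP => a; rewrite inE; apply/negP => /FA[_]; rewrite A0 inE.
have [s ss sP] : exists2 s, size s = 5 & clique_model (edge_rel F) A s.
  apply: (@dense_clique_model _ 4) => //; first exact: edge_rel_sym.
    exact: edge_rel_irr.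
  by rewrite (degree_sum_edge_rel FA).
have [a [b [aF bF Xab]]] := Xforced oF sP ss.
have ab : a != b.
  by apply/eqP => E; have := Xdisj Xab; rewrite E /vertex_disjoint /= !inE eqxx !orbT.
have cF : #|F| = #|F :\ a|.+1 by rewrite (cardsD1 a) aF.
have := IHk (F :\ a); rewrite -ltnS -cF => /(_ leF) IH.
have {IH} : (2 * #|F :\ a| <= 16 * #|A| + crossing_count X (F :\ a))%N.
  by apply: IH => c; rewrite !inE => /andP[_ /FA].
(* Deleting [a] destroys at least the ordered pairs (a, b) and (b, a). *)
suff : (crossing_count X (F :\ a) + 2 <= crossing_count X F)%N by lia.
rewrite /crossing_count [leqRHS](big_setD1 a aF) /=.
have -> : (\sum_(c in F :\ a) \sum_(d in F) X c d =
    \sum_(c in F :\ a) X c a + \sum_(c in F :\ a) \sum_(d in F :\ a) X c d)%N.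
  by rewrite -big_split; apply: eq_bigr => c _; rewrite (big_setD1 a aF).
rewrite addnA addnC leq_add2r (big_setD1 b bF) Xab /=.
by rewrite (big_setD1 (A := F :\ a) b) ?inE 1?eq_sym ?ab ?bF //= Xsym Xab; lia.
Qed.

Variable R : realFieldType.
Implicit Types (w : edge -> R) (P : 'I_n -> R).

Definition crossing_sum (f : edge -> edge -> R) : R :=
  \sum_(a | oriented a) \sum_(b | oriented b) (X a b)%:R * f a b.

Lemma crossing_sum_le f g : (forall a b, oriented a -> oriented b -> X a b -> f a b <= g a b) ->
  crossing_sum f <= crossing_sum g.
Proof.
move=> fg; apply: ler_sum => a oa; apply: ler_sum => b ob.
by case: (boolP (X a b)) => Xab; rewrite ?mul1r ?mul0r //; apply: fg.
Qed.

Lemma crossing_sumD f g : crossing_sum (fun a b => f a b + g a b) = crossing_sum f + crossing_sum g.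
Proof.
rewrite /crossing_sum -big_split; apply: eq_bigr => a _.
by rewrite -big_split; apply: eq_bigr => b _; rewrite mulrDr.
Qed.

Lemma crossing_sumZ c f : crossing_sum (fun a b => c * f a b) = c * crossing_sum f.
Proof.
rewrite /crossing_sum mulr_sumr; apply: eq_bigr => a _.
by rewrite mulr_sumr; apply: eq_bigr => b _; rewrite mulrCA.
Qed.

Lemma crossing_sum_indicator F : {in F, forall a, oriented a} ->
  crossing_sum (fun a b => (a \in F)%:R * (b \in F)%:R) = (crossing_count X F)%:R.
Proof.
move=> oF; rewrite /crossing_count natr_sum /crossing_sum big_mkcond [RHS]big_mkcond /=.
apply: eq_bigr => a _; case: ifP => oa; last first.
  by case: (boolP (a \in F)) => // /oF; rewrite oa.
case: ifP => aF; last by rewrite big1 // => b _; rewrite mul0r mulr0.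
rewrite natr_sum big_mkcond [RHS]big_mkcond /=; apply: eq_bigr => b _.
case: ifP => ob; last by case: (boolP (b \in F)) => // /oF; rewrite ob.
by case: ifP => bF; rewrite ?mulr1 ?mulr0.
Qed.

Lemma crossing_linear_real F A :
  {in F, forall a, [/\ oriented a, a.1 \in A & a.2 \in A]} ->
  2 * \sum_(a | oriented a) (a \in F)%:R <= 16 * \sum_u (u \in A)%:R +
    crossing_sum (fun a b => (a \in F)%:R * (b \in F)%:R).
Proof.
move=> FA; rewrite crossing_sum_indicator; last by move=> a /FA[].
have -> : \sum_(a | oriented a) (a \in F)%:R = #|F|%:R :> R.
  rewrite -sum1_card natr_sum big_mkcond [RHS]big_mkcond; apply: eq_bigr => a _.
  by case: (boolP (a \in F)) => [/FA[->]|_] //=; rewrite if_same.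
have -> : \sum_u (u \in A)%:R = #|A|%:R :> R.
  by rewrite -sum1_card natr_sum [RHS]big_mkcond; apply: eq_bigr => a _; case: ifP.
by rewrite -!natrM -natrD ler_nat crossing_count_linear.
Qed.

(* Layer cake: peel off the smallest positive weight [t] and apply the linear
   bound to the edges that carry weight and the vertices with [t <= P u]. *)
Lemma crossing_sum_min w P :
  (forall a, 0 <= w a) -> (forall u, 0 <= P u) ->
  (forall a, oriented a -> w a <= P a.1 /\ w a <= P a.2) ->
  2 * \sum_(a | oriented a) w a <= 16 * \sum_u P u + crossing_sum (fun a b => Num.min (w a) (w b)).
Proof.
have [k] := ubnP #|[set a | oriented a && (0 < w a)]|.
elim: k w P => // k IHk w P; set F := [set a | _] => leF w0 P0 wP.
have [F0|/set0Pn[a0 a0F]] := eqVneq F set0.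
  rewrite big1; last first.
    move=> a oa; apply/eqP; rewrite eq_le w0 andbT leNgt; apply/negP => wa.
    have : a \in F by rewrite inE oa wa.
    by rewrite F0 inE.
  rewrite mulr0 addr_ge0 // ?mulr_ge0 ?sumr_ge0 //.
  move=> a _; apply: sumr_ge0 => b _; rewrite mulr_ge0 //.
  by rewrite le_min !w0.
case: (arg_minP (P := mem F) w a0F) => a1 a1F0 a1min; have a1F : a1 \in F := a1F0.
set t := w a1 in a1min.
have t0 : 0 < t by move: a1F; rewrite inE => /andP[].
pose U := [set u | t <= P u].
pose w' a := w a - t * (a \in F)%:R; pose P' u := P u - t * (u \in U)%:R.
have w'0 a : 0 <= w' a.
  by rewrite /w'; case: (boolP (a \in F)) => [/a1min|_]; rewrite ?mulr1 ?mulr0 ?subr0 ?subr_ge0.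
have P'0 u : 0 <= P' u.
  by rewrite /P' inE; case: (boolP (t <= P u)) => [|_]; rewrite ?mulr1 ?mulr0 ?subr0 ?subr_ge0.
have FU : {in F, forall a, [/\ oriented a, a.1 \in U & a.2 \in U]}.
  move=> a aF; have := a1min a aF; move: aF; rewrite !inE => /andP[oa _] ta.
  by have [w1 w2] := wP a oa; split=> //; apply: le_trans ta _.
have IH := IHk w' P' _ w'0 P'0.
have {IH} : 2 * \sum_(a | oriented a) w' a <= 16 * \sum_u P' u +
    crossing_sum (fun a b => Num.min (w' a) (w' b)).
  apply: IH; last first.
    move=> a oa; have [w1 w2] := wP a oa.
    have [aF|aF] := boolP (a \in F).
      by have [_ aU1 aU2] := FU a aF; rewrite /w' /P' aF aU1 aU2 !mulr1 !lerD2r.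
    rewrite /w' (negbTE aF) mulr0 subr0.
    suff -> : w a = 0 by split; apply: P'0.
    apply/eqP; rewrite eq_le w0 andbT leNgt; apply/negP => wa.
    by move: aF; rewrite inE oa wa.
  (* The support shrinks, because the minimal edge [a1] drops to weight 0. *)
  apply: leq_trans (proper_card _) leF.
  apply/properP; split.
    apply/subsetP => a; rewrite !inE => /andP[-> /lt_le_trans]; apply.
    by rewrite lerBlDr lerDl mulr_ge0 // ltW.
  by exists a1 => //; rewrite inE /w' a1F mulr1 subrr ltxx andbF.
have := crossing_linear_real FU; rewrite -(ler_pM2l t0).
have -> : \sum_(a | oriented a) w a = \sum_(a | oriented a) w' a +
    t * \sum_(a | oriented a) (a \in F)%:R.
  by rewrite mulr_sumr -big_split; apply: eq_bigr => a _; rewrite /w' /= subrK.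
have -> : \sum_u P u = \sum_u P' u + t * \sum_u (u \in U)%:R.
  by rewrite mulr_sumr -big_split; apply: eq_bigr => a _; rewrite /P' /= subrK.
(* For two edges of [F] both weights drop by exactly [t]; otherwise the indicator product is 0 and
   [w'] is at most [w]. *)
have : crossing_sum (fun a b => Num.min (w' a) (w' b)) +
    t * crossing_sum (fun a b => (a \in F)%:R * (b \in F)%:R) <=
    crossing_sum (fun a b => Num.min (w a) (w b)).
  rewrite -crossing_sumZ -crossing_sumD; apply: crossing_sum_le => a b _ _ _.
  set m := Num.min (w' a) (w' b).
  have [] : m <= w' a /\ m <= w' b by rewrite /m !ge_min !lexx orbT.
  rewrite le_min /w'; case: (a \in F); case: (b \in F); rewrite ?(mulr1, mulr0, subr0, addr0);
    by move=> m1 m2; apply/andP; split; have := t0; lra.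
lra.
Qed.

(** Keep each vertex with probability [p], and an edge between kept vertices with the conditional
    probability that brings its total to [q]; then take expectations in the linear bound. *)
Lemma crossing_sum_mul (p : 'I_n -> R) (q : edge -> R) :
  (forall u, 0 <= p u <= 1) ->
  (forall a, oriented a -> 0 <= q a <= p a.1 * p a.2) ->
  2 * \sum_(a | oriented a) q a <= 16 * \sum_u p u + crossing_sum (fun a b => q a * q b).
Proof.
move=> p01 qp.
pose pi (i : 'I_n + edge) := match i with
  | inl u => p u
  | inr a => if oriented a then q a / (p a.1 * p a.2) else 0 end.
pose pr (S : {set 'I_n + edge}) := \prod_i if i \in S then pi i else 1 - pi i.
have p0 u : 0 <= p u by case/andP: (p01 u).
have pi01 i : 0 <= pi i <= 1.
  case: i => [u|a] //=; case: ifP => oa; last by rewrite lexx ler01.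
  have /andP[q0 qle] := qp a oa.
  (* A vanishing product makes the quotient 0, the value of division by zero. *)
  have [pp|pp] := eqVneq (p a.1 * p a.2) 0; first by rewrite pp invr0 mulr0 lexx ler01.
  have pp0 : 0 < p a.1 * p a.2 by rewrite lt0r pp mulr_ge0.
  by rewrite divr_ge0 ?(ltW pp0) //= ler_pdivrMr // mul1r.
have pr0 S : 0 <= pr S.
  apply: prodr_ge0 => i _; have /andP[h0 h1] := pi01 i.
  by case: ifP => // _; rewrite subr_ge0.
have piq a : oriented a -> p a.1 * p a.2 * pi (inr a) = q a.
  move=> oa; rewrite /= oa; have /andP[q0 qle] := qp a oa.
  have [pp|pp] := eqVneq (p a.1 * p a.2) 0; last by rewrite mulrC divfK.
  by apply/eqP; rewrite pp mul0r eq_sym eq_le q0 andbT -pp.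
pose dom a : seq ('I_n + edge) := [:: inl a.1; inl a.2; inr a].
pose F (S : {set 'I_n + edge}) := [set a | oriented a && all (mem S) (dom a)].
pose A (S : {set 'I_n + edge}) := [set u | inl u \in S].
have Ea a : oriented a -> \sum_S pr S * (a \in F S)%:R = q a.
  move=> oa; rewrite -(piq a oa).
  transitivity (\sum_S pr S * (all (mem S) (dom a))%:R).
    by apply: eq_bigr => S _; rewrite inE oa.
  rewrite sum_bernoulli_seq /dom ?big_cons ?big_nil ?mulr1 ?mulrA //.
  rewrite /= !inE !negb_or !andbT /=; apply/eqP => -[E].
  by move: oa; rewrite /oriented E ltnn.
(* Crossing edges are vertex-disjoint, so their six random choices are distinct and the
   probabilities multiply. *)
have Eab a b : oriented a -> oriented b -> X a b ->
    \sum_S pr S * ((a \in F S)%:R * (b \in F S)%:R) = q a * q b.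
  move=> oa ob Xab; rewrite -(piq a oa) -(piq b ob).
  transitivity (\sum_S pr S * (all (mem S) (dom a ++ dom b))%:R).
    by apply: eq_bigr => S _; rewrite !inE oa ob all_cat -natrM mulnb.
  rewrite sum_bernoulli_seq; first by rewrite !big_cons big_nil /=; ring.
  have := Xdisj Xab; rewrite /vertex_disjoint /= !inE !negb_or !andbT.
  have inlE x y : (inl x == inl y :> 'I_n + edge) = (x == y) by [].
  have inrE x y : (inr x == inr y :> 'I_n + edge) = (x == y) by [].
  rewrite !inlE !inrE => /and3P[/and3P[-> -> ->] /andP[-> ->] ->] /=.
  by rewrite andbT; apply: contraTneq Xab => ->; apply/negP => /Xdisj;
    rewrite /vertex_disjoint /= !inE eqxx !orbT.
have Ev u : \sum_S pr S * (u \in A S)%:R = p u.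
  transitivity (\sum_S pr S * (all (mem S) [:: inl u])%:R).
    by apply: eq_bigr => S _; rewrite inE /= andbT.
  by rewrite sum_bernoulli_seq // big_seq1.
have lin S : pr S * (2 * \sum_(a | oriented a) (a \in F S)%:R) <=
    pr S * (16 * \sum_u (u \in A S)%:R +
      crossing_sum (fun a b => (a \in F S)%:R * (b \in F S)%:R)).
  apply: ler_wpM2l (pr0 S) _ _ _; apply: crossing_linear_real => a.
  by rewrite !inE /= => /and4P[-> -> -> _].
have : \sum_S pr S * (2 * \sum_(a | oriented a) (a \in F S)%:R) <=
    \sum_S pr S * (16 * \sum_u (u \in A S)%:R +
      crossing_sum (fun a b => (a \in F S)%:R * (b \in F S)%:R)).
  by apply: ler_sum => S _; exact: lin.
have -> : \sum_S pr S * (2 * \sum_(a | oriented a) (a \in F S)%:R) = 2 * \sum_(a | oriented a) q a.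
  under eq_bigr => S _ do rewrite mulrCA mulr_sumr.
  rewrite -mulr_sumr exchange_big /=; congr (_ * _).
  by apply: eq_bigr => a oa; rewrite Ea.
have -> // : \sum_S pr S * (16 * \sum_u (u \in A S)%:R +
   crossing_sum (fun a b => (a \in F S)%:R * (b \in F S)%:R)) =
   16 * \sum_u p u + crossing_sum (fun a b => q a * q b).
under eq_bigr => S _ do rewrite mulrDr mulrCA mulr_sumr.
rewrite big_split /= -mulr_sumr exchange_big /=; congr (_ * _ + _).
  by apply: eq_bigr => u _; rewrite Ev.
under eq_bigr => S _ do rewrite -crossing_sumZ.
rewrite /crossing_sum exchange_big /=; apply: eq_bigr => a oa.
rewrite exchange_big /=; apply: eq_bigr => b ob.
rewrite -mulr_sumr; case: (boolP (X a b)) => Xab; last by rewrite !mul0r.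
by rewrite Eab.
Qed.

End Linear.
End Crossings.

From mathcomp Require Import all_classical all_reals all_analysis.
From mathcomp Require Import Rstruct Rstruct_topology.
Import numFieldNormedType.Exports.

(** * Splitting the weights into a heavy and a light part *)

Section Estimate.
Variables (R : rcfType) (n : nat) (X : rel ('I_n * 'I_n)).
Hypotheses (Xsym : symmetric X) (Xforced : forces_crossing X).
Hypothesis Xdisj : forall a b, X a b -> vertex_disjoint a b.
Local Notation edge := ('I_n * 'I_n)%type.

(** One part carries at least 3/16 r^2 of the weight. Doubled, this is 3/8 r^2, and the vertex term
    takes away at most r^2 / 4: in the heavy case 16 r, bounded through [64 <= r], and in the light
    case 16 times [t * \sum_u p u]. Half of the remaining r^2 / 8, times [t], is the claim. *)
Lemma weighted_crossing_bound (W : edge -> R) (P : 'I_n -> R) (r : R) :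
  (0 < n)%N -> 64 <= r ->
  (forall u, 0 <= P u) -> (forall a, 0 <= W a) ->
  (forall a, W a <= P a.1 /\ W a <= P a.2) ->
  \sum_u P u <= r -> 3 / 8 * r ^+ 2 <= \sum_(a | oriented a) W a ->
  r ^+ 5 / (16 ^+ 4 * n%:R) <= 2^-1 * crossing_sum X (fun a b => W a * W b).
Proof.
move=> n0 r64 P0 W0 WP Pr Wr.
have N0 : 0 < n%:R :> R by rewrite ltr0n.
have r0 : 0 < r by lra.
(* Chosen so that t n (64 / r) = r^2 / 64, as the AM-GM step for the vertex probabilities
   requires. *)
pose t := r ^+ 3 / (64 ^+ 2 * n%:R).
have t0 : 0 < t by rewrite divr_gt0 ?exprn_gt0 ?mulr_gt0.
have -> : r ^+ 5 / (16 ^+ 4 * n%:R) = t * (r ^+ 2 / 16).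
  by rewrite /t; field; rewrite gt_eqF.
have rr : 64 * r <= r ^+ 2 by rewrite expr2 ler_pM2r.
pose heavy a := Num.max (W a - t) 0.
pose light a := Num.min (W a / t) 1.
have split_W a : W a = heavy a + t * light a.
  rewrite /heavy /light; case: (lerP (W a / t) 1);
    rewrite ?(ler_pdivrMr _ _ t0) ?(ltr_pdivlMr _ _ t0) mul1r => h.
    rewrite max_r ?subr_le0 // add0r mulrC divfK ?gt_eqF //.
  by rewrite max_l ?subr_ge0 1?ltW // mulr1 subrK.
have heavy0 a : 0 <= heavy a by rewrite /heavy le_max lexx orbT.
have light0 a : 0 <= light a by rewrite /light le_min ler01 divr_ge0 // ltW.
have sum_W : \sum_(a | oriented a) W a =
    \sum_(a | oriented a) heavy a + t * \sum_(a | oriented a) light a.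
  by rewrite mulr_sumr -big_split; apply: eq_bigr => a _; rewrite /= -split_W.
have [hv|lt] := lerP (3 / 16 * r ^+ 2) (\sum_(a | oriented a) heavy a).
  have hW a : heavy a <= W a by rewrite (split_W a) lerDl mulr_ge0 // ltW.
  have := @crossing_sum_min _ _ Xsym Xforced Xdisj R heavy P heavy0 P0.
  move/(_ (fun a _ => conj (le_trans (hW a) (proj1 (WP a))) (le_trans (hW a) (proj2 (WP a))))).
  set M := crossing_sum X _ => HM.
  (* If both edges exceed [t], one weight is at least [t] and the other at least the minimum of the
     heavy parts; otherwise that minimum is 0. *)
  have : t * M <= crossing_sum X (fun a b => W a * W b).
    rewrite -crossing_sumZ; apply: crossing_sum_le => a b _ _ _.
    have wa := W0 a; have wb := W0 b.
    rewrite /heavy; case: (lerP (W a - t) 0) => ha.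
      by rewrite (le_trans _ (mulr_ge0 wa wb)) // pmulr_rle0 // ge_min lexx.
    case: (lerP (W b - t) 0) => hb.
      by rewrite (le_trans _ (mulr_ge0 wa wb)) // pmulr_rle0 // ge_min lexx orbT.
    apply: ler_pM; first exact: ltW.
    - by rewrite le_min (ltW ha) (ltW hb).
    - lra.
    - by rewrite ge_min; apply/orP; right; lra.
  have : r ^+ 2 / 16 <= 2^-1 * M by lra.
  rewrite -(ler_pM2l t0); lra.
have lw : 3 / 16 * r ^+ 2 <= t * \sum_(a | oriented a) light a by lra.
pose y u := Num.sqrt (P u / t).
pose p u := Num.min 1 (y u).
have y0 u : 0 <= y u by rewrite sqrtr_ge0.
have y2 u : y u ^+ 2 = P u / t by rewrite sqr_sqrtr // divr_ge0 // ltW.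
have p01 u : 0 <= p u <= 1 by rewrite /p le_min ler01 y0 ge_min lexx.
have lp a : oriented a -> 0 <= light a <= p a.1 * p a.2.
  move=> _; rewrite light0 /=; have [w1 w2] := WP a.
  have tV : 0 < t^-1 by rewrite invr_gt0.
  apply: min_le_mul_min => //; first exact: divr_ge0 (W0 a) (ltW t0).
    by rewrite y2 ler_pM2r.
  by rewrite y2 ler_pM2r.
have := @crossing_sum_mul _ _ Xsym Xforced Xdisj R p light p01 lp.
set M := crossing_sum X _ => HM.
(* Each [t * light] is at most the corresponding weight. *)
have HM2 : t ^+ 2 * M <= crossing_sum X (fun a b => W a * W b).
  rewrite -crossing_sumZ; apply: crossing_sum_le => a b _ _ _.
  have -> : t ^+ 2 * (light a * light b) = (t * light a) * (t * light b) by ring.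
  have tl c : 0 <= t * light c <= W c.
    by rewrite mulr_ge0 ?(ltW t0) //= (split_W c) lerDr.
  have /andP[? ?] := tl a; have /andP[? ?] := tl b.
  exact: ler_pM.
(* AM-GM with the parameter [r / 64] *)
have sp : t * \sum_u p u <= r ^+ 2 / 64.
  have pu u : p u <= (r / 64 * (P u / t) + 64 / r) / 2.
    have yp : p u <= y u by rewrite /p ge_min lexx orbT.
    apply: (le_trans yp); rewrite -y2.
    have := sqr_ge0 (r / 64 * y u - 1) => h.
    rewrite -(ler_pM2l r0).
    have -> : r * ((r / 64 * y u ^+ 2 + 64 / r) / 2) = 32 * ((r / 64 * y u) ^+ 2 + 1).
      by field; rewrite gt_eqF.
    have -> : r * y u = 64 * (r / 64 * y u) by field.
    nra.
  have : \sum_u p u <= \sum_u (r / 64 * (P u / t) + 64 / r) / 2.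
    by apply: ler_sum => u _; exact: pu.
  rewrite -mulr_suml big_split /= sumr_const card_ord -mulr_sumr -mulr_suml -[_ *+ n]mulr_natr.
  rewrite -(ler_pM2l t0) => /le_trans; apply.
  have -> : t * ((r / 64 * ((\sum_u P u) / t) + 64 / r * n%:R) / 2) =
     (r / 64 * (\sum_u P u) + r ^+ 2 / 64) / 2.
    rewrite /t; field; rewrite ?gt_eqF //.
  nra.
have : r ^+ 2 / 16 <= 2^-1 * (t * M).
  by move: HM; rewrite -(ler_pM2l t0); lra.
rewrite -(ler_pM2l t0); lra.
Qed.

End Estimate.

(** * Pair weights and the moments of the random set *)

Section Moments.
Variables (R : realType) (n : nat) (mu : {ffun {set 'I_n} -> R}).
Hypotheses (mu0 : forall S, 0 <= mu S) (mu1 : \sum_(S : {set 'I_n}) mu S = 1).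

Lemma pair_weight_ge0 u v : 0 <= pair_weight mu u v.
Proof. exact: sumr_ge0. Qed.

Lemma pair_weightC u v : pair_weight mu u v = pair_weight mu v u.
Proof. by apply: eq_bigl => S; rewrite andbC. Qed.

(** The diagonal value [pair_weight mu u u] is Pr[u in S], the vertex weight of the estimate
    above. *)
Lemma pair_weight_diag u v : pair_weight mu u v <= pair_weight mu u u.
Proof.
rewrite /pair_weight big_mkcond [leRHS]big_mkcond; apply: ler_sum => S _ /=.
by case: (u \in S); case: (v \in S) => /=.
Qed.

Lemma sum_pair_weight : \sum_u \sum_v pair_weight mu u v = second_moment mu.
Proof.
rewrite /second_moment pair_big /= /pair_weight (exchange_big_dep xpredT) //=.
apply: eq_bigr => S _; rewrite (eq_bigl (mem (finset.setX S S))).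
  by rewrite sumr_const cardsX mulnn mulr_natr.
by move=> [u v]; rewrite !inE.
Qed.

Lemma sum_pair_weight_diag : \sum_u pair_weight mu u u = \sum_S mu S * #|S|%:R.
Proof.
rewrite /pair_weight (exchange_big_dep xpredT) //=.
apply: eq_bigr => S _; rewrite (eq_bigl (mem S)) ?sumr_const ?mulr_natr //.
by move=> u; rewrite andbb.
Qed.

(** Average 2 r |S| <= r^2 + |S|^2 over [mu], with r^2 the second moment. *)
Lemma first_moment_le : 0 < second_moment mu ->
  \sum_u pair_weight mu u u <= Num.sqrt (second_moment mu).
Proof.
set r := Num.sqrt _ => m0; have r0 : 0 < r by rewrite sqrtr_gt0.
have r2 : r ^+ 2 = second_moment mu by rewrite sqr_sqrtr // ltW.
rewrite sum_pair_weight_diag.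
have : \sum_S mu S * (2 * r * #|S|%:R) <= \sum_S mu S * (r ^+ 2 + (#|S| ^ 2)%:R).
  apply: ler_sum => S _; apply: ler_wpM2l => //; rewrite natrX.
  by have := sqr_ge0 (r - #|S|%:R); lra.
under eq_bigr => S _ do rewrite mulrCA.
rewrite -mulr_sumr; under [X in _ <= X]eq_bigr => S _ do rewrite mulrDr.
rewrite big_split /= -mulr_suml mu1 mul1r -/(second_moment mu) -r2.
nra.
Qed.

(** The full double sum splits into the pairs u < v, the pairs v < u of equal weight, and the
    diagonal. *)
Lemma sum_pair_weight_oriented :
  2 * \sum_(a | oriented a) pair_weight mu a.1 a.2 =
  second_moment mu - \sum_u pair_weight mu u u.
Proof.
apply/eqP; rewrite eq_sym subr_eq eq_sym; apply/eqP.
rewrite -sum_pair_weight pair_big /=.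
rewrite [RHS](bigID (@oriented n)) /= mulr_natl mulr2n -addrA; congr (_ + _).
rewrite [RHS](bigID (fun a : 'I_n * 'I_n => oriented (a.2, a.1))) /=; congr (_ + _).
  have swK : involutive (fun p : 'I_n * 'I_n => (p.2, p.1)) by case.
  rewrite (reindex_inj (inv_inj swK)) /=.
  apply: eq_big => [[u v]|[u v] _] /=; last by rewrite pair_weightC.
  by rewrite /oriented /=; lia.
rewrite -(pair_big_dep xpredT
  (fun u v => (~~ oriented (u, v)) && (~~ oriented (v, u)))
  (fun u v => pair_weight mu u v)) /=.
apply: eq_bigr => u _; rewrite (big_pred1 u) // => v.
by rewrite /oriented /= -!leqNgt -eqn_leq -val_eqE.
Qed.

End Moments.

(** * Sampling the arcs of a drawing *)

Section Arcs.
Local Open Scope classical_set_scope.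
Variable R : realType.
Local Notation point := (R * R)%type.
Local Notation unit_interval := [set t : R | 0 <= t <= 1].
Implicit Types g h : R -> point.

Lemma compact_unit_interval : compact unit_interval.
Proof.
have -> : unit_interval = `[0, 1]%classic by apply/seteqP; split => t /=; rewrite in_itv.
exact: segment_compact.
Qed.

Lemma within_unit_near g : {within unit_interval, continuous g} ->
  forall s d : R, 0 <= s <= 1 -> 0 < d ->
  \forall t \near s, 0 <= t <= 1 -> `|g s - g t| < d.
Proof.
move=> /subspace_continuousP cg s d s01 d0.
by have /cvgrPdist_lt/(_ _ d0) := cg s s01.
Qed.

(** Heine-Cantor through the near-covering form of compactness, applied to the filter of moduli [e]
    tending to 0 from the right: only a local statement at each [s] is left to prove. *)
Lemma unit_uniform_continuity g : {within unit_interval, continuous g} ->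
  forall d : R, 0 < d -> exists2 e : R, 0 < e &
    forall s t : R, 0 <= s <= 1 -> 0 <= t <= 1 -> `|s - t| < e -> `|g s - g t| < d.
Proof.
move=> cg d d0.
have /compact_near_coveringP/near_covering_withinP cov := compact_unit_interval.
pose P (e s : R) := forall t, 0 <= t <= 1 -> `|s - t| < e -> `|g s - g t| < d.
have H : \forall e \near (0 : R)^'+, unit_interval `<=` P e.
  apply: cov => s /= s01.
  have d20 : 0 < d / 2 by rewrite divr_gt0.
  have /nbhs_ballP[r /= r0 Hr] := within_unit_near cg s01 d20.
  have r20 : 0 < r / 2 by rewrite divr_gt0.
  exists (ball s (r / 2), [set e | e < r / 2]).
    by split => /=; [exact: nbhsx_ballx | exact: nbhs_right_lt].
  move=> [t e] /= [st er] t01 u u01 tu.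
  have H1 : `|g s - g t| < d / 2 by apply: Hr => //; apply: lt_le_trans st _; lra.
  have H2 : `|g s - g u| < d / 2.
    apply: Hr => //; rewrite /ball /=; have := ler_distD t s u.
    move: st; rewrite /ball /=; lra.
  by have := ler_distD (g s) (g t) (g u); rewrite (distrC (g t) (g s)); lra.
near (0 : R)^'+ => e.
have He : unit_interval `<=` P e by near: e.
by exists e => // s t s01; apply: He.
Unshelve. all: by end_near. Qed.

(** Near-covering compactness of the square of parameters: at distance m, moving either point by
    less than m / 4 leaves more than m / 2. *)
Lemma disjoint_arcs_dist g h : {within unit_interval, continuous g} ->
  {within unit_interval, continuous h} ->
  (forall s t : R, 0 <= s <= 1 -> 0 <= t <= 1 -> g s != h t) ->
  exists2 d : R, 0 < d &
    forall s t : R, 0 <= s <= 1 -> 0 <= t <= 1 -> d <= `|g s - h t|.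
Proof.
move=> cg ch gh.
have /compact_near_coveringP/near_covering_withinP cov :=
  compact_setX compact_unit_interval compact_unit_interval.
pose P (e : R) (p : R * R) := e <= `|g p.1 - h p.2|.
have H : \forall e \near (0 : R)^'+, unit_interval `*` unit_interval `<=` P e.
  apply: cov => -[s t] /= [s01 t01].
  set m := `|g s - h t|; have m0 : 0 < m by rewrite normr_gt0 subr_eq0 gh.
  have m40 : 0 < m / 4 by rewrite divr_gt0.
  have Hs := within_unit_near cg s01 m40; have Ht := within_unit_near ch t01 m40.
  exists ([set s' | 0 <= s' <= 1 -> `|g s - g s'| < m / 4] `*`
          [set t' | 0 <= t' <= 1 -> `|h t - h t'| < m / 4], [set e | e < m / 2]).
    split => /=; last by apply: nbhs_right_lt; rewrite divr_gt0.
    by exists ([set s' | 0 <= s' <= 1 -> `|g s - g s'| < m / 4],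
               [set t' | 0 <= t' <= 1 -> `|h t - h t'| < m / 4]).
  move=> [[s' t'] e] /= [[Hs' Ht'] em] [s'01 t'01]; rewrite /P /=.
  have := Hs' s'01; have := Ht' t'01; rewrite (distrC (h t)).
  have := ler_distD (g s') (g s) (h t); have := ler_distD (h t') (g s') (h t).
  rewrite -/m; lra.
near (0 : R)^'+ => e.
have He : unit_interval `*` unit_interval `<=` P e by near: e.
by exists e => // s t s01 t01; apply: (He (s, t)).
Unshelve. all: by end_near. Qed.
End Arcs.

Lemma chain_cross_path (L : eqType) (s : L -> L -> L -> bool) (r1 r2 : rel L) x t d u :
  (forall a b a' b', r1 a b -> r2 a' b' -> seg_cross s a b a' b' = false) ->
  path r1 x t -> path r2 d u -> chain_cross s x t d u = false.
Proof.
move=> H; elim: u d => // e u IH d p1 /= /andP[de p2].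
rewrite IH // addbF; elim: t x p1 {IH} => //= y t IH x /andP[xy p1].
by rewrite IH // addbF; apply: H.
Qed.

Lemma common_pos (R : realDomainType) (I : finType) (P : I -> R -> Prop) :
  (forall i d e, 0 < e -> e <= d -> P i d -> P i e) ->
  (forall i, exists2 d, 0 < d & P i d) -> exists2 d, 0 < d & forall i, P i d.
Proof.
move=> mono ex.
suff [d d0 H] : exists2 d, 0 < d & forall i, i \in enum I -> P i d.
  by exists d => // i; apply: H; rewrite mem_enum.
elim: (enum I) => [|i s [d d0 H]]; first by exists 1.
have [e e0 Pe] := ex i; exists (Num.min d e); first by rewrite lt_min d0 e0.
have m0 : 0 < Num.min d e by rewrite lt_min d0 e0.
move=> j; rewrite inE => /orP[/eqP->|js].
  by apply: mono Pe; rewrite // ge_min lexx orbT.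
by apply: mono (H j js); rewrite // ge_min lexx.
Qed.

Lemma connected_in_connect (T L : finType) (e : rel T) (r : rel L) (h : T -> L) (B : {set T}) :
  connected_in e B ->
  {in B &, forall x y, e x y -> connect r (h x) (h y)} ->
  {in B &, forall x y, connect r (h x) (h y)}.
Proof.
move=> cB step x y xB yB; have /connectP[p] := cB x y xB yB.
elim: p x xB => [|z p IH] x xB /=; first by move=> _ ->; apply: connect0.
case/andP=> /and3P[xz _ zB] pz yl; apply: connect_trans (step _ _ xB zB xz) _.
exact: IH.
Qed.

(** * From a clique minor to a crossing pair of edges in a drawing *)

Section DrawingCrossing.
Variables (R : realType) (n : nat) (E : rel 'I_n) (D : drawing R E).
Local Notation edge := ('I_n * 'I_n)%type.
Implicit Types (a b : edge) (F : {set edge}) (A : {set 'I_n}).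

(** Pairs with a common end are left out, since the parity argument concerns independent chains;
    omitting them can only weaken a lower bound. *)
Definition drawing_crosses a b :=
  [&& is_edge E a.1 a.2, is_edge E b.1 b.2, vertex_disjoint a b &
      `[< crossings D a.1 a.2 b.1 b.2 !=set0 >]%classic].

Definition edge_arc a : R -> R * R := dcurve D a.1 a.2.

Lemma edge_arcP a : is_edge E a.1 a.2 ->
  arc_between (edge_arc a) (dpos D a.1) (dpos D a.2).
Proof. by case/andP=> lt ea; apply: dcurve_arc. Qed.

(** [crossings] sees only interior parameters. At the ends, arcs are kept apart by the distinct
    vertex positions and by the rule that no arc passes through a vertex. *)
Lemma edge_arc_disjoint a b : is_edge E a.1 a.2 -> is_edge E b.1 b.2 ->
  vertex_disjoint a b -> ~~ drawing_crosses a b ->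
  forall s t, 0 <= s <= 1 -> 0 <= t <= 1 -> edge_arc a s != edge_arc b t.
Proof.
move=> ea eb dab; rewrite /drawing_crosses ea eb dab /= => /asboolPn nX s t s01 t01.
have unit (x : R) : 0 <= x <= 1 -> [\/ x = 0, x = 1 | 0 < x < 1].
  move=> /andP[]; rewrite le_eqVlt => /orP[/eqP<-|x0]; first by constructor 1.
  rewrite le_eqVlt => /orP[/eqP->|x1]; first by constructor 2.
  by constructor 3; rewrite x0.
have ends c : is_edge E c.1 c.2 -> edge_arc c 0 = dpos D c.1 /\ edge_arc c 1 = dpos D c.2.
  by case/edge_arcP=> _ [-> [-> _]].
have [a0 a1] := ends a ea; have [b0 b1] := ends b eb.
have inn c v x : is_edge E c.1 c.2 -> 0 < x < 1 -> edge_arc c x != dpos D v.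
  by case/andP=> lt ec x01; apply/eqP; apply: dcurve_avoid.
have pn u v : u != v -> dpos D u != dpos D v by apply: contra => /eqP/dpos_inj ->.
move: dab; rewrite /vertex_disjoint /= !inE !negb_or.
case/and4P => /and3P[_ ab1 ab2] /andP[ab3 ab4] _ _.
by case: (unit s s01) => [->|->|si]; case: (unit t t01) => [->|->|ti];
  rewrite ?a0 ?a1 ?b0 ?b1 ?pn ?inn // 1?eq_sym ?inn //;
  apply/eqP => eq_st; apply: nX; exists (edge_arc b t); exists s, t.
Qed.

Section Sampling.
Variables (F : {set edge}) (N : nat).

(* [inr (a, k)] is the point of the arc of [a] at the parameter k / N.+1; the
   ends of the arc are labelled by the vertices instead. *)
Definition label : finType := ('I_n + edge * 'I_N.+1)%type.

Definition sample a k : label :=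
  if k == 0%N then inl a.1 else if k == N.+1 then inl a.2 else inr (a, inord k).

Definition label_pos (l : label) : R * R :=
  match l with
  | inl u => dpos D u
  | inr (a, k) => edge_arc a (k%:R / N.+1%:R)
  end.

Definition label_in A (l : label) :=
  match l with inl u => u \in A | inr (a, _) => (a.1 \in A) && (a.2 \in A) end.

(** Symmetric, because a chain may follow an arc backwards. Both ends of the edge must lie in [A],
    so that disjoint vertex sets give chains without common labels. *)
Definition consecutive A : rel label := fun l m =>
  [exists a : edge, exists k : 'I_N.+1,
    [&& a \in F, a.1 \in A, a.2 \in A &
      ((l == sample a k) && (m == sample a k.+1)) ||
      ((m == sample a k) && (l == sample a k.+1))]].

Lemma consecutive_sym A : symmetric (consecutive A).
Proof.
by move=> l m; apply: eq_existsb => a; apply: eq_existsb => k; rewrite orbC.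
Qed.

Lemma sample_in A a k : a.1 \in A -> a.2 \in A -> label_in A (sample a k).
Proof. by rewrite /sample => a1 a2; do 2!case: ifP => //=; rewrite a1 a2. Qed.

Lemma consecutive_in A l m : consecutive A l m -> label_in A m.
Proof.
move=> /existsP[a /existsP[k /and4P[_ a1 a2]]].
by case/orP=> /andP[]; [move=> _ /eqP-> | move=> /eqP-> _]; apply: sample_in.
Qed.

Lemma path_label_in A x t : label_in A x -> path (consecutive A) x t ->
  {in x :: t, forall l, label_in A l}.
Proof.
elim: t x => [|y t IH] x xA /=; first by move=> _ l; rewrite inE => /eqP->.
case/andP=> xy yt l; rewrite inE => /orP[/eqP-> //|].
exact: IH (consecutive_in xy) yt l.
Qed.

Lemma label_in_disjoint A A' l : [disjoint A & A'] -> label_in A l -> ~~ label_in A' l.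
Proof.
move=> /pred0P dis.
have dA u : u \in A -> u \notin A' by move=> uA; have /= := dis u; rewrite uA => /= ->.
by case: l => [u /dA //|[a k]] /= /andP[/dA a1 _]; rewrite (negbTE a1).
Qed.

Lemma connect_edge A u v : edge_rel F u v -> u \in A -> v \in A ->
  connect (consecutive A) (inl u) (inl v).
Proof.
have csym : connect_sym (consecutive A) by apply/sym_connect_sym/consecutive_sym.
suff H a : a \in F -> a.1 \in A -> a.2 \in A ->
    connect (consecutive A) (inl a.1) (inl a.2).
  by move=> /orP[] aF uA vA; [have := H _ aF uA vA | rewrite csym; have := H _ aF vA uA].
move=> aF a1 a2.
have -> : inl a.2 = sample a N.+1 by rewrite /sample eqxx.
suff : forall k, (k <= N.+1)%N -> connect (consecutive A) (inl a.1) (sample a k) by apply.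
elim=> [|k IH] kN; first exact: connect0.
apply: connect_trans (IH (ltnW kN)) (connect1 _).
by apply/existsP; exists a; apply/existsP; exists (Ordinal kN); rewrite aF a1 a2 !eqxx.
Qed.

Lemma label_pos_sample a k : is_edge E a.1 a.2 -> (k <= N.+1)%N ->
  label_pos (sample a k) = edge_arc a (k%:R / N.+1%:R).
Proof.
move=> /edge_arcP [_ [a0 [a1 _]]] kN; rewrite /sample.
have [->|k0] := eqVneq k 0%N; first by rewrite mul0r a0.
have [->|kN'] := eqVneq k N.+1; first by rewrite divff ?pnatr_eq0 // a1.
by rewrite /= inordK // ltn_neqAle kN'.
Qed.
End Sampling.


Lemma vertex_disjoint_sets A A' a b : is_edge E a.1 a.2 -> is_edge E b.1 b.2 ->
  [disjoint A & A'] -> a.1 \in A -> a.2 \in A -> b.1 \in A' -> b.2 \in A' ->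
  vertex_disjoint a b.
Proof.
move=> /andP[la _] /andP[lb _] /pred0P dis a1 a2 b1 b2.
have dA u v : u \in A -> v \in A' -> u != v.
  by move=> uA vA; apply/eqP => uv; have /= := dis u; rewrite uA uv vA.
rewrite /vertex_disjoint /= !inE !negb_or (dA _ _ a1 b1) (dA _ _ a1 b2) (dA _ _ a2 b1)
  (dA _ _ a2 b2) !andbT -!val_eqE /=.
by rewrite (ltn_eqF la) (ltn_eqF lb).
Qed.

(** Let d be a lower bound for the distances between the disjoint arcs. Samples d / 8 apart and a
    perturbation by d / 16 keep each polygonal segment within 3 d / 16 of one arc point, so a
    crossing would bring two such arcs within 3 d / 8. *)
Lemma exists_sampling F : {in F, forall a, is_edge E a.1 a.2} ->
  {in F &, forall a b, ~~ drawing_crosses a b} ->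
  exists N (g : label N -> R * R), general_position g /\
    forall A A' l m l' m', [disjoint A & A'] ->
      consecutive F A l m -> consecutive F A' l' m' ->
      seg_cross (counterclockwise g) l m l' m' = false.
Proof.
move=> eF noX.
have [d d0 dist] : exists2 d : R, 0 < d & forall ab : edge * edge,
    ab.1 \in F -> ab.2 \in F -> vertex_disjoint ab.1 ab.2 ->
    forall s t : R, 0 <= s <= 1 -> 0 <= t <= 1 ->
      d <= `|edge_arc ab.1 s - edge_arc ab.2 t|.
  apply: common_pos => [ab d e e0 ed H aF bF dab s t s01 t01|[a b] /=].
    exact: le_trans ed (H aF bF dab s t s01 t01).
  have [/and3P[aF bF dab]|nF] := boolP [&& a \in F, b \in F & vertex_disjoint a b]; last first.
    by exists 1 => // aF bF dab; case/negP: nF; rewrite aF bF.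
  have [ca _] := edge_arcP (eF a aF); have [cb _] := edge_arcP (eF b bF).
  have [d d0 H] := disjoint_arcs_dist ca cb
    (edge_arc_disjoint (eF a aF) (eF b bF) dab (noX a b aF bF)).
  by exists d.
have d80 : 0 < d / 8 by rewrite divr_gt0.
have [e e0 unif] : exists2 e : R, 0 < e & forall a, a \in F ->
    forall s t : R, 0 <= s <= 1 -> 0 <= t <= 1 -> `|s - t| < e ->
      `|edge_arc a s - edge_arc a t| < d / 8.
  apply: common_pos => [a r e e0 er H aF s t s01 t01 st|a].
    exact: H aF s t s01 t01 (lt_le_trans st er).
  have [aF|aF] := boolP (a \in F); last by exists 1.
  have [ca _] := edge_arcP (eF a aF).
  by have [e e0 H] := unit_uniform_continuity ca d80; exists e.
(* The parameter step 1 / (N + 1) must lie below the common modulus [e]. *)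
pose N := Num.bound e^-1.
have Ne : N.+1%:R^-1 < e.
  rewrite -[ltRHS]invrK ltf_pV2 ?posrE ?invr_gt0 ?ltr0n //.
  apply: lt_le_trans (archi_boundP _) _; first by rewrite invr_ge0 ltW.
  by rewrite ler_nat.
have d160 : 0 < d / 16 by rewrite divr_gt0.
have [g gen near_g] := perturb_general_position (@label_pos N) d160.
exists N, g; split=> // A A' l m l' m' dis lm lm'.
pose Near (l m : label N) a (k : nat) := a \in F /\ 0 <= (k%:R / N.+1%:R : R) <= 1 /\
  {in [:: l; m], forall i, `|(g i).1 - (edge_arc a (k%:R / N.+1%:R)).1| <= 3 * d / 16 /\
                          `|(g i).2 - (edge_arc a (k%:R / N.+1%:R)).2| <= 3 * d / 16}.
have local B x y : consecutive F B x y -> exists a k, [/\ a.1 \in B, a.2 \in B & Near x y a k].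
  case/existsP=> a /existsP[k /and4P[aF a1 a2 xy]]; exists a, (k : nat).
  have N0 : 0 < N.+1%:R :> R by rewrite ltr0n.
  have in01 j : (j <= N.+1)%N -> 0 <= (j%:R / N.+1%:R : R) <= 1.
    by move=> jN; rewrite divr_ge0 //= ler_pdivrMr // mul1r ler_nat.
  have kN : (k <= N.+1)%N := ltnW (ltn_ord k).
  split=> //; split=> //; split; first exact: in01.
  have close j : (j <= N.+1)%N -> (j = k \/ j = k.+1) ->
      `|edge_arc a (j%:R / N.+1%:R) - edge_arc a (k%:R / N.+1%:R)| < d / 8.
    move=> jN jk; apply: unif => //; try exact: in01.
    rewrite -mulrBl; case: jk => ->; first by rewrite subrr mul0r normr0.
    by rewrite -natr1 addrAC subrr add0r mul1r ger0_norm ?invr_ge0.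
  move=> i i_xy.
  have [j [jN jk ->]] : exists j, [/\ (j <= N.+1)%N, j = k \/ j = k.+1 & i = sample N a j].
    have [->|->] : i = sample N a k \/ i = sample N a k.+1.
      by case/orP: xy => /andP[/eqP Ex /eqP Ey]; move: i_xy; rewrite !inE Ex Ey => /orP[]/eqP->; auto.
    by exists k; split=> //; left.
    by exists k.+1; split=> //; right.
  have := close j jN jk; have [] := near_g (sample N a j).
  rewrite (label_pos_sample (eF a aF) jN) prod_normE gt_max /= => g1 g2 /andP[c1 c2].
  clear -d0 g1 g2 c1 c2; move: g1 g2 c1 c2; rewrite !ler_norml !ltr_norml.
  by move=> /andP[? ?] /andP[? ?] /andP[? ?] /andP[? ?]; split; apply/andP; split; lra.
have [a [k [a1 a2 [aF [k01 Na]]]]] := local _ _ _ lm.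
have [b [j [b1 b2 [bF [j01 Nb]]]]] := local _ _ _ lm'.
apply/negP => /seg_cross_near/(_ Na Nb)[n1 n2].
have := dist (a, b) aF bF (vertex_disjoint_sets (eF a aF) (eF b bF) dis a1 a2 b1 b2) _ _ k01 j01.
rewrite prod_normE le_max /=; clear -d0 n1 n2 => /orP[]; lra.
Qed.

Lemma pick_vertices (B : nat -> {set 'I_n}) : (forall i, (i < 5)%N -> B i != finset.set0) ->
  exists c : nat -> 'I_n, forall i, (i < 5)%N -> c i \in B i.
Proof.
move=> B0; have /set0Pn[u0 _] := B0 0%N isT.
suff /boolp.choice[c cP] : forall i, exists u, (i < 5)%N -> u \in B i by exists c.
move=> i.
have [i5|] := ltnP i 5; last by exists u0.
by have /set0Pn[u uB] := B0 i i5; exists u.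
Qed.

(** Choose a vertex in each branch set and join the i-th to the j-th by a chain of samples inside
    the union of their branch sets. Independent chains use disjoint unions, so without crossing
    edges they would contradict [K5_chains_cross]. *)
Lemma drawing_forces_crossing : (forall u v : 'I_n, (u < v)%N -> E u v) ->
  forces_crossing drawing_crosses.
Proof.
move=> Eall F A0 s oF [sP pw] ss; apply: contrapT => none.
have eF : {in F, forall a, is_edge E a.1 a.2}.
  by move=> a /oF oa; rewrite /is_edge Eall // andbT.
have noX : {in F &, forall a b, ~~ drawing_crosses a b}.
  by move=> a b aF bF; apply/negP => Xab; apply: none; exists a, b.
have [N [g [gen flat]]] := exists_sampling eF noX.
pose B i := nth finset.set0 s i.
have Bs i : (i < 5)%N -> B i \in s by move=> i5; rewrite mem_nth ?ss.
have [c cB] : exists c : nat -> 'I_n, forall i, (i < 5)%N -> c i \in B i.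
  by apply: pick_vertices => i /Bs /sP[].
have pwB i j : (i < j < 5)%N -> [disjoint B i & B j] && linked (edge_rel F) (B i) (B j).
  move=> /andP[ij j5]; move/(pairwiseP finset.set0): pw => H.
  by apply: (H i j); rewrite ?inE ?ss //; apply: ltn_trans ij j5.
have disB i j : (i < 5)%N -> (j < 5)%N -> i != j -> [disjoint B i & B j].
  move=> i5 j5; rewrite neq_ltn => /orP[ij|ji].
    by have := pwB i j; rewrite ij j5 => /(_ isT)/andP[].
  by rewrite disjoint_sym; have := pwB j i; rewrite ji i5 => /(_ isT)/andP[].
pose A i j := B i :|: B j.
have conn i j : (i < j < 5)%N -> connect (@consecutive F N (A i j)) (inl (c i)) (inl (c j)).
  move=> ij; have /andP[ij' j5] := ij; have i5 := ltn_trans ij' j5.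
  have inside k : (k < 5)%N -> B k \subset A i j ->
    {in B k &, forall x y, connect (@consecutive F N (A i j)) (inl x) (inl y)}.
    move=> k5 sub; have [_ _ cBk] := sP _ (Bs k k5).
    apply: connected_in_connect cBk _ => x y xB yB exy.
    by apply: connect_edge exy _ _; apply: (fintype.subsetP sub).
  have /andP[_ /existsP[x /andP[xB /existsP[y /andP[yB exy]]]]] := pwB i j ij.
  apply: connect_trans (inside i i5 (finset.subsetUl _ _) _ _ (cB i i5) xB) _.
  apply: connect_trans (inside j j5 (finset.subsetUr _ _) _ _ yB (cB j j5)).
  by apply: connect_edge exy _ _; rewrite !inE ?xB ?yB ?orbT.
have [ch chP] : exists ch : nat * nat -> seq (label N), forall ij, (ij.1 < ij.2 < 5)%N ->
    path (@consecutive F N (A ij.1 ij.2)) (inl (c ij.1)) (ch ij) /\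
    last (inl (c ij.1)) (ch ij) = inl (c ij.2).
  suff /boolp.choice[ch chP] : forall ij : nat * nat, exists t, (ij.1 < ij.2 < 5)%N ->
    path (@consecutive F N (A ij.1 ij.2)) (inl (c ij.1)) t /\
    last (inl (c ij.1)) t = inl (c ij.2) by exists ch.
  move=> [i j] /=.
  have [ij|] := boolP (i < j < 5)%N; last by exists [::].
  by have /connectP[t pt lt] := conn i j ij; exists t => _; split.
apply: (K5_chains_cross (chirotope_counterclockwise gen) (c := fun i => inl (c i))
  (ch := fun i j => ch (i, j))).
- have neq i j : (i < 5)%N -> (j < 5)%N -> i != j -> (inl (c i) : label N) != inl (c j).
    move=> i5 j5 ij; apply/eqP => -[cij].
    have /pred0P/(_ (c i)) := disB i j i5 j5 ij.
    by rewrite /= cB // cij cB.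
  by rewrite /= !inE !negb_or !neq.
- by move=> i j ij; have [] := chP (i, j) ij.
- move=> i j k l ij kl u.
  have [p1 _] := chP (i, j) ij; have [p2 _] := chP (k, l) kl.
  have /andP[ij' j5] := ij; have i5 := ltn_trans ij' j5.
  have /andP[kl' l5] := kl; have k5 := ltn_trans kl' l5.
  have dis : [disjoint A i j & A k l].
    move: u; rewrite /= !inE !negb_or => /and4P[/and3P[_ ik il] /andP[jk jl] _ _].
    apply/pred0P => x /=; rewrite !inE.
    have D0 p q : (p < 5)%N -> (q < 5)%N -> p != q -> (x \in B p) && (x \in B q) = false.
      by move=> p5 q5 pq; have /pred0P/(_ x) := disB p q p5 q5 pq.
    by rewrite andb_orl !andb_orr !D0.
  split; last exact: chain_cross_path (fun _ _ _ _ => flat _ _ _ _ _ _ dis) p1 p2.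
  move=> x xt; apply/negP => xu.
  have ci : c i \in A i j by rewrite inE cB.
  have ck : c k \in A k l by rewrite inE cB.
  have xA := path_label_in (x := inl (c i)) ci p1 xt.
  have xA' := path_label_in (x := inl (c k)) ck p2 xu.
  by have := label_in_disjoint dis xA; rewrite xA'.
Qed.

End DrawingCrossing.

(** * The crossing weight of a drawing and the final bound *)

Lemma vertex_disjointC n (a b : 'I_n * 'I_n) : vertex_disjoint a b = vertex_disjoint b a.
Proof.
rewrite /vertex_disjoint (_ : [:: b.1; b.2; a.1; a.2] = [:: b.1; b.2] ++ [:: a.1; a.2]) //.
by rewrite uniq_catC.
Qed.

Lemma drawing_crosses_sym (R : realType) n (E : rel 'I_n) (D : drawing R E) :
  symmetric (drawing_crosses D).
Proof.
move=> a b; rewrite /drawing_crosses vertex_disjointC andbCA; do 3!congr (_ && _).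
by apply: asbool_equiv_eq; split=> -[p [s [t [s01 [t01 [ps pt]]]]]]; exists p, t, s.
Qed.

(** A marked pair meets in at least one point, which already contributes 1 to [ncross]; all other
    terms are nonnegative. Both sides halve a sum over ordered pairs. *)
Lemma crossing_sum_le_weight (R : realType) n (E : rel 'I_n) (W : 'I_n -> 'I_n -> R)
  (D : drawing R E) : (forall u v, 0 <= W u v) ->
  ((2^-1 * crossing_sum (drawing_crosses D) (fun a b => W a.1 a.2 * W b.1 b.2))%:E
    <= crossing_weight W D)%E.
Proof.
move=> W0; rewrite EFinM /crossing_weight; apply: lee_pmul => //.
  rewrite lee_fin; apply: sumr_ge0 => a _; apply: sumr_ge0 => b _.
  by rewrite !mulr_ge0.
rewrite pair_big /=.
under [leRHS]eq_bigr => a _ do rewrite pair_big /=.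
rewrite /crossing_sum -sumEFin big_mkcond /=; apply: lee_sum => a _.
have ge0 b : (0 <= if is_edge E a.1 a.2 && is_edge E b.1 b.2 && ((a.1, a.2) != (b.1, b.2))
   then (W a.1 a.2 * W b.1 b.2)%:E * ncross D a.1 a.2 b.1 b.2 else 0)%E.
  by case: ifP => // _; rewrite mule_ge0 ?lee_fin ?mulr_ge0 // esum_ge0.
case: ifP => _; last by apply: sume_ge0.
rewrite -sumEFin big_mkcond /=; apply: lee_sum => b _.
case: ifP => _; last exact: ge0.
case: (boolP (drawing_crosses D a b)) => [|_]; last by rewrite mul0r; apply: ge0.
case/and4P=> ea eb dab /asboolP[p pX].
rewrite ea eb mul1r ifT; last first.
  by apply: contraTneq dab => -[e1 e2]; rewrite /vertex_disjoint e1 e2 /= !inE eqxx !orbT.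
rewrite -[leLHS]mule1; apply: lee_pmul => //; first by rewrite lee_fin mulr_ge0.
apply: esum_ge; exists [set p]%classic; last by rewrite fsbig_set1.
split; first exact: finite_set1.
by move=> _ ->.
Qed.

Theorem theorem1p3 :
  exists C c : Rdefinitions.R, 1 <= C /\ 0 < c /\
  forall (n : nat) (mu : {ffun {set 'I_n} -> Rdefinitions.R}),
    (1 <= n)%N ->
    (forall S, 0 <= mu S) -> \sum_(S : {set 'I_n}) mu S = 1 ->
    C <= second_moment mu ->
    ((c / n%:R * (second_moment mu) `^ (5%:R / 2%:R))%:E
       <= cr (@complete_rel n) (pair_weight mu))%E.
Proof.
(* 64^2 makes the root of the second moment at least 64, as the estimate demands, and 16^4 is the
   constant of that estimate. *)
exists (64 ^+ 2), (16 ^+ 4)^-1; split; first by rewrite expr_ge1 // ler1n.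
split; first by rewrite invr_gt0 exprn_gt0.
move=> n mu n0 mu0 mu1; set m := second_moment mu => Cm.
have m0 : 0 < m by apply: lt_le_trans Cm; rewrite exprn_gt0.
pose r := Num.sqrt m; have r2 : r ^+ 2 = m by rewrite sqr_sqrtr // ltW.
have r64 : 64 <= r by rewrite -(ler_pXn2r (n := 2)) ?nnegrE ?sqrtr_ge0 // r2.
have -> : m `^ (5%:R / 2%:R) = r ^+ 5.
  by rewrite mulrC powRrM powR12_sqrt ?(ltW m0) // powR_mulrn // sqrtr_ge0.
apply: le_ereal_inf_tmp => _ [D _ <-].
apply: le_trans (crossing_sum_le_weight D (pair_weight_ge0 mu0)).
have -> : (16 ^+ 4)^-1 / n%:R * r ^+ 5 = r ^+ 5 / (16 ^+ 4 * n%:R) by rewrite mulrC [in RHS]invfM.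
rewrite lee_fin.
apply: (@weighted_crossing_bound _ _ _ _ _ _ (fun a => pair_weight mu a.1 a.2)
  (fun u => pair_weight mu u u)) => //.
- exact: drawing_crosses_sym.
- apply: drawing_forces_crossing => u v uv.
  by rewrite /complete_rel -val_eqE /= ltn_eqF.
- by move=> a b /and4P[].
- by move=> u; apply: pair_weight_ge0.
- by move=> a; apply: pair_weight_ge0.
- move=> a; split; first exact: pair_weight_diag.
  by rewrite pair_weightC; apply: pair_weight_diag.
- exact: first_moment_le.
(* The total weight is at least (r^2 - r) / 2, and r is at most r^2 / 64, which leaves more than 3/8
   r^2. *)
- have := sum_pair_weight_oriented mu; have := first_moment_le mu0 mu1 m0.
  rewrite -/m -/r; have : 64 * r <= r ^+ 2 by rewrite expr2 ler_pM2r //; lra.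
  by rewrite -r2; lra.
Qed.
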